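(* Assume that the single birth $Q$-matrix $Q=(q_{ij})$ on $E=\mathbb Z_+$ is irreducible and the corresponding process is recurrent. Then $$\mathbb E_0\sigma_0=\frac1{q_{01}}+d,\qquad \mathbb E_n\sigma_0=\sum_{k=0}^{n-1}\big(F_k^{(0)}d-d_k\big),\qquad n\ge 1,$$ where $$d=\varlimsup_{k\to\infty}\frac{\sum_{n=0}^kd_n}{\sum_{n=0}^kF_n^{(0)}},$$ and $d=\lim_{n\to\infty}d_n/F_n^{(0)}$ if the latter limit exists. Furthermore, the process is ergodic (i.e. positive recurrent) if and only if $d<\infty$; and it is strongly ergodic if and only if $$\sup_{k\in E}\sum_{n=0}^k\big(F_n^{(0)}d-d_n\big)<\infty.$$ Actually, for the last conclusion (the strong ergodicity criterion), the recurrence assumption can be replaced by the assumption that the process is unique (non-explosive).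
   Context: A single birth $Q$-matrix on $\mathbb Z_+=\{0,1,2,\dots\}$ is a real matrix $Q=(q_{ij})$ with $q_{ij}\ge 0$ for $i\neq j$, which is conservative ($\sum_j q_{ij}=0$ for every $i$), irreducible, and satisfies $q_{i,i+1}>0$ and $q_{i,i+j}=0$ for all $i\in\mathbb Z_+$ and $j\ge 2$. $X(t)$ is the corresponding continuous-time Markov chain, $\mathbb E_n$ is expectation for the chain started at $n$, and $\sigma_0=\inf\{t\ge\eta_1:X(t)=0\}$, where $\eta_1$ is the first jump time. The quantities $d$ and $\mathbb E_n\sigma_0$ may be $+\infty$ (convention $0\cdot\infty=0$). Define $q_n^{(k)}=\sum_{j=0}^kq_{nj}$ for $0\le k<n$, $$F_i^{(i)}=1,\qquad F_n^{(i)}=\frac1{q_{n,n+1}}\sum_{k=i}^{n-1}q_n^{(k)}F_k^{(i)},\qquad n>i\ge 0,$$ $$d_0=0,\qquad d_n=\frac1{q_{n,n+1}}\Bigg(1+\sum_{k=0}^{n-1}q_n^{(k)}d_k\Bigg),\qquad n\ge 1.$$ Strongly ergodic means that there is a probability measure $\pi$ on $E$ with $\sup_{i\in E}\sum_j|p_{ij}(t)-\pi_j|\to0$ as $t\to\infty$, where $(p_{ij}(t))$ is the transition function. *)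

(* Defs.v *)
From HB Require Import structures.
From mathcomp Require Export all_boot all_order all_algebra.
From mathcomp Require Export all_classical all_reals all_analysis.

Set Implicit Arguments.
Unset Strict Implicit.
Unset Printing Implicit Defensive.

Import Order.TTheory GRing.Theory Num.Theory.
Import numFieldNormedType.Exports.

Local Open Scope classical_set_scope.
Local Open Scope ring_scope.

Section Qmatrix.
Context {R : realType}.
Implicit Types (Q : nat -> nat -> R) (i j k n : nat).

Definition irreducible Q : Prop :=
  forall i j, exists s : seq nat, path (fun a b => 0 < Q a b) i s /\ last i s = j.

Record single_birth Q : Prop := SingleBirth {
  sb_ge0 : forall i j, i != j -> 0 <= Q i j;
  sb_conservative : forall i, series (Q i) n @[n --> \oo] --> (0 : R);
  sb_irreducible : irreducible Q;
  sb_birth : forall i, 0 < Q i i.+1;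
  sb_skip_free : forall i j, (2 <= j)%N -> Q i (i + j)%N = 0 }.

Definition qsum Q n k : R := \sum_(j < k.+1) Q n j.

(* Course-of-values recursion; it is only used through its fixpoint equation
   [strong_recE]. *)
Fixpoint history (step : nat -> (nat -> R) -> R) n : seq R :=
  if n is m.+1 then
    rcons (history step m) (step m (fun k => nth 0 (history step m) k))
  else [::].

Definition strong_rec step n : R := step n (fun k => nth 0 (history step n) k).

Definition Fseq Q i : nat -> R := strong_rec (fun n f =>
  if n == i then 1
  else (Q n n.+1)^-1 * \sum_(i <= k < n) qsum Q n k * f k).

Definition dseq Q : nat -> R := strong_rec (fun n f =>
  if n == 0%N then 0
  else (Q n n.+1)^-1 * (1 + \sum_(0 <= k < n) qsum Q n k * f k)).

Lemma size_history step n : size (history step n) = n.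
Proof. by elim: n => //= n IHn; rewrite size_rcons IHn. Qed.

Lemma nth_history step n k :
  (k < n)%N -> nth 0 (history step n) k = strong_rec step k.
Proof.
elim: n => // n IHn; rewrite ltnS leq_eqVlt /= nth_rcons size_history.
by case/orP => [/eqP->|kn]; [rewrite ltnn eqxx | rewrite kn IHn].
Qed.

Lemma strong_recE step n :
  (forall f g, (forall k, (k < n)%N -> f k = g k) -> step n f = step n g) ->
  strong_rec step n = step n (strong_rec step).
Proof. by move=> ext; apply: ext => k; exact: nth_history. Qed.

Lemma Fseqii Q i : Fseq Q i i = 1.
Proof. by rewrite /Fseq strong_recE ?eqxx. Qed.

Lemma FseqE Q i n : (i < n)%N ->
  Fseq Q i n = (Q n n.+1)^-1 * \sum_(i <= k < n) qsum Q n k * Fseq Q i k.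
Proof.
move=> lt_in; rewrite {1}/Fseq strong_recE ?gtn_eqF// => f g fg.
congr (_ * _); rewrite big_nat [RHS]big_nat.
by apply: eq_bigr => k /andP[_ kn]; rewrite fg.
Qed.

Lemma dseq0 Q : dseq Q 0 = 0.
Proof. by rewrite /dseq strong_recE. Qed.

Lemma dseqE Q n : (0 < n)%N ->
  dseq Q n =
    (Q n n.+1)^-1 * (1 + \sum_(0 <= k < n) qsum Q n k * dseq Q k).
Proof.
move=> n_gt0; rewrite {1}/dseq strong_recE ?gtn_eqF// => f g fg.
congr (_ * (1 + _)); rewrite big_nat [RHS]big_nat.
by apply: eq_bigr => k /andP[_ kn]; rewrite fg.
Qed.

(* The denominators are at least F_0^(0) = 1. *)
Definition dlimsup Q : \bar R :=
  limn_esup (fun k =>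
    ((\sum_(n < k.+1) dseq Q n) / (\sum_(n < k.+1) Fseq Q 0 n))%:E).

(* F_n^(0) may vanish: the quotient is taken in \bar R, where x / 0 = +oo for
   x > 0, and d_n > 0 for n >= 1. *)
Definition dratio Q n : \bar R := ((dseq Q n)%:E / (Fseq Q 0 n)%:E)%E.

End Qmatrix.

Section Chain.
Context {R : realType} {disp : measure_display} {Omega : measurableType disp}.
Variables (Q : nat -> nat -> R) (P : nat -> probability Omega R).
Variables (Y : nat -> Omega -> nat) (hold : nat -> Omega -> R).
Implicit Types (i j k n : nat) (t : R) (w : Omega).

Definition jump_rate i : R := - Q i i.

Definition jump_prob i j : R := if i == j then 0 else Q i j / jump_rate i.

(* Under P i, the jump chain Y is the Markov chain with transition matrix
   [jump_prob] started at i and, given Y, the holding times hold k are independent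
   and exponential with rates [jump_rate (Y k)].  The last field is the
   resulting joint law of (Y 0, hold 0, ..., Y n, hold n).  All states are
   nonabsorbing since q_{i,i+1} > 0. *)
Record markov_chain : Prop := MarkovChain {
  mc_measurable_jump : forall n, measurable_fun setT (Y n);
  mc_measurable_hold : forall n, measurable_fun setT (hold n);
  mc_hold_gt0 : forall n w, 0 < hold n w;
  mc_law : forall i n (y : nat -> nat) (t : nat -> R),
    (forall k, 0 <= t k) ->
    P i [set w | forall k, (k <= n)%N -> Y k w = y k /\ t k < hold k w] =
    ((y 0%N == i)%:R * (\prod_(k < n) jump_prob (y k) (y k.+1))
     * \prod_(k < n.+1) expR (- (jump_rate (y k) * t k)))%:E }.

Definition jump_time n w : R := \sum_(k < n) hold k w.

(* The state at time t; None is the cemetery, entered at explosion. *)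
Definition X t w : option nat :=
  xget None
    [set Some (Y n w) | n in [set n | jump_time n w <= t < jump_time n.+1 w]].

Definition return_time i w : \bar R :=
  ereal_inf [set t%:E | t in [set t | jump_time 1 w <= t /\ X t w = Some i]].

Definition mean_return n i : \bar R := (\int[P n]_w return_time i w)%E.

Definition recurrent : Prop :=
  forall i, P i [set w | (return_time i w < +oo)%E] = 1%E.

Definition positive_recurrent : Prop := forall i, (mean_return i i < +oo)%E.

Definition non_explosive : Prop :=
  forall i, P i [set w | jump_time n w @[n --> \oo] --> +oo%R] = 1%E.

Definition trans t i j : R := fine (P i [set w | X t w = Some j]).

Definition l1_dist (pi : probability nat R) t i : \bar R :=
  (\sum_(0 <= j <oo) (`|trans t i j - fine (pi [set j])|%R : R)%:E)%E.

Definition strongly_ergodic : Prop :=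
  exists pi : probability nat R,
    ereal_sup (range (l1_dist pi t)) @[t --> +oo%R] --> 0%E.

End Chain.

(* Main.v *)
(* Let m_b(i) be the mean return time to b from i.  Summing over n the mean of the
   n-th holding time on the event that the jump chain has avoided b so far exhibits
   m_b as the series [mean_time b i] of iterates of a killed kernel, hence as the
   minimal solution of the first-step equation.  For b = 0 that equation reads
   Q g = -1 off 0; since the chain is skip-free upwards, its solutions vanishing at 0
   are g_c(n) = sum_(k < n) (c F_k - d_k), with c = g(1).  If m_0(1) = c is finite
   then m_0 = g_c off 0, so g_c >= 0, which forces d <= c.  Conversely, for c > d the
   solution g_c is bounded below and, the return to 0 being certain, dominates
   m_0.  Hence m_0(1) = d, and all the other mean return times follow from g_d or
   from Lyapunov functions built on it.

   If the mean return times to 0 are bounded, then P_i(X_T = 0) >= delta uniformly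
   in i for some T, and Doeblin's argument makes the transition function converge
   uniformly to a limit that is a probability.  Conversely, strong ergodicity
   gives such a minorization, so that the return time to 0 has a geometric tail,
   uniformly in the starting point. *)

From HB Require Import structures.
From mathcomp Require Import ring lra zify measurable_realfun.
Require Import Defs.

Set Implicit Arguments.
Unset Strict Implicit.
Unset Printing Implicit Defensive.

Import Order.TTheory GRing.Theory Num.Theory.
Import numFieldNormedType.Exports.
Local Open Scope classical_set_scope.
Local Open Scope ring_scope.

(** * The killed jump kernel and Poisson's equation *)

(** [mc_law] describes only finitely many jumps and holding times, with nonnegative thresholds.
    Events about [X] involve unboundedly many jumps, so each is cut into events of finite horizon,
    where a pi-system argument applies, and is reassembled by a series or a monotone limit.

    The formula for m_0 must also hold when d is infinite. That m_0(1) is infinite does not at once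
    give the same for m_0(n): the first-step equation carries finiteness along possible jumps,
    always from n to n+1 but downwards only where a rate is positive. A separate Lyapunov function
    closes this gap.

    If g_c >= -C, stopping after m jumps gives m_0 <= g_c up to an error C P(no return within m
    jumps). Certain return makes the error vanish. Bounding that probability by 1 still shows that
    m_0 is finite, and non-explosion then excludes trajectories that never return, because their
    holding times sum to infinity. This is the route to the strong ergodicity criterion from
    non-explosion. *)

Section SingleBirth.
Context {R : realType} (Q : nat -> nat -> R) (Q_sb : single_birth Q).
Implicit Types (i j k n b : nat) (f g V : nat -> R).

Lemma rate_up2 i j : (i.+2 <= j)%N -> Q i j = 0.
Proof.
by move=> ij; rewrite -(@subnKC i j) ?(sb_skip_free Q_sb)//; lia.
Qed.

Lemma rate_sum i : \sum_(j < i.+2) Q i j = 0.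
Proof.
rewrite -[RHS](cvg_lim _ (sb_conservative Q_sb i))//.
apply/esym/lim_near_cst => //; exists i.+2 => // n /= in_.
rewrite /series/= (@big_cat_nat _ _ _ i.+2)//= big_mkord [X in _ + X]big1_seq ?addr0//.
by move=> j /andP[_]; rewrite mem_index_iota => /andP[ij _]; rewrite rate_up2.
Qed.

Lemma jump_rate_gt0 i : 0 < jump_rate Q i.
Proof.
rewrite /jump_rate oppr_gt0.
have := rate_sum i; rewrite 2!big_ord_recr/= => /eqP; rewrite -addrA addr_eq0.
move=> /eqP s; have : 0 <= \sum_(j < i) Q i j.
  by apply: sumr_ge0 => j _; apply: (sb_ge0 Q_sb); rewrite gtn_eqF.
have := sb_birth Q_sb i; lra.
Qed.

Let q_gt0 := jump_rate_gt0.
Let q_neq0 i : jump_rate Q i != 0. Proof. by rewrite gt_eqF. Qed.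

Lemma jump_prob_ge0 i j : 0 <= jump_prob Q i j.
Proof.
rewrite /jump_prob; case: eqVneq => // ij.
by rewrite divr_ge0 ?(ltW (q_gt0 _)) ?(sb_ge0 Q_sb).
Qed.

Lemma jump_prob_up2 i j : (i.+2 <= j)%N -> jump_prob Q i j = 0.
Proof. by move=> ij; rewrite /jump_prob rate_up2// mul0r if_same. Qed.

Lemma jump_prob_succ_gt0 i : 0 < jump_prob Q i i.+1.
Proof.
by rewrite /jump_prob ltn_eqF// divr_gt0 ?(sb_birth Q_sb)//.
Qed.

(** Skip-freeness upwards makes this finite sum the whole row of Q f, so that it makes sense for
    unbounded f. *)
Definition generator f i : R := \sum_(j < i.+2) Q i j * f j.

Lemma sum_jump_prob f i :
  \sum_(j < i.+2) jump_prob Q i j * f j = f i + generator f i / jump_rate Q i.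
Proof.
have hi : (i < i.+2)%N by [].
rewrite /generator (bigD1 (Ordinal hi))//= {1}/jump_prob eqxx mul0r add0r.
rewrite [X in _ = _ + X / _](bigD1 (Ordinal hi))//= mulrDl addrA.
have -> : f i + Q i i * f i / jump_rate Q i = 0.
  by move: (q_neq0 i); rewrite /jump_rate oppr_eq0 => qi; field.
rewrite add0r mulr_suml; apply: eq_bigr => j.
rewrite -val_eqE/= eq_sym => ij; rewrite /jump_prob (negbTE ij).
by rewrite mulrAC.
Qed.

Lemma jump_prob_sum1 i : \sum_(j < i.+2) jump_prob Q i j = 1.
Proof.
have := sum_jump_prob (fun=> 1) i; rewrite /generator.
under eq_bigr do rewrite mulr1; move=> ->.
under eq_bigr do rewrite mulr1.
by rewrite rate_sum mul0r addr0.
Qed.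

(** Only entrances into b are killed; the starting state may be b itself, so returns from b to b are
    covered as well. *)
Definition killed b f i : R :=
  \sum_(j < i.+2 | nat_of_ord j != b) jump_prob Q i j * f j.

Lemma killed_if b f i : killed b f i =
  \sum_(j < i.+2) (if nat_of_ord j != b then jump_prob Q i j else 0) * f j.
Proof.
by rewrite /killed big_mkcond; apply: eq_bigr => j _; case: ifP; rewrite ?mul0r.
Qed.

Lemma killedE b f i : killed b f i =
  f i + generator f i / jump_rate Q i - jump_prob Q i b * f b.
Proof.
rewrite -sum_jump_prob /killed.
have [bi|bi] := ltnP b i.+2; last first.
  rewrite jump_prob_up2// mul0r subr0; apply: eq_bigl => j.
  by rewrite neq_ltn (leq_trans (ltn_ord j)).
by rewrite [X in _ = X - _](bigD1 (Ordinal bi))//= addrAC subrr add0r.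
Qed.

Lemma killed_ge0 b f i : (forall j, 0 <= f j) -> 0 <= killed b f i.
Proof. by move=> f0; apply: sumr_ge0 => j _; rewrite mulr_ge0 ?jump_prob_ge0. Qed.

Lemma le_killed b f g i :
  (forall j, j != b -> f j <= g j) -> killed b f i <= killed b g i.
Proof.
by move=> fg; apply: ler_sum => j jb; rewrite ler_wpM2l ?jump_prob_ge0 ?fg.
Qed.

Lemma eq_killed b f g i :
  (forall j, j != b -> f j = g j) -> killed b f i = killed b g i.
Proof. by move=> fg; apply: eq_bigr => j jb; rewrite fg. Qed.

Lemma killedD b f g i :
  killed b (fun j => f j + g j) i = killed b f i + killed b g i.
Proof. by rewrite -big_split; apply: eq_bigr => j _; rewrite mulrDr. Qed.

Lemma killedZ b c f i : killed b (fun j => c * f j) i = c * killed b f i.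
Proof. by rewrite mulr_sumr; apply: eq_bigr => j _; rewrite mulrCA. Qed.

Lemma killed_sum b m (f : nat -> nat -> R) i :
  killed b (fun j => \sum_(k < m) f k j) i = \sum_(k < m) killed b (f k) i.
Proof.
rewrite exchange_big; apply: eq_bigr => j _.
by rewrite mulr_sumr.
Qed.

Lemma killed1_le1 b i : killed b (fun=> 1) i <= 1.
Proof.
rewrite -[leRHS](jump_prob_sum1 i) /killed.
under eq_bigr do rewrite mulr1.
by rewrite [leRHS](bigID (fun j : 'I_i.+2 => nat_of_ord j != b))/= lerDl
  sumr_ge0// => j _; exact: jump_prob_ge0.
Qed.

Lemma iter_killed_ge0 b f m i : (forall j, 0 <= f j) -> 0 <= iter m (killed b) f i.
Proof. by move=> f0; elim: m i => //= m IH i; apply: killed_ge0. Qed.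

Lemma iter_killedS b f m : iter m.+1 (killed b) f = iter m (killed b) (killed b f).
Proof. by rewrite iterSr. Qed.

Lemma le_iter_killed b f g m i : i != b ->
  (forall j, j != b -> f j <= g j) -> iter m (killed b) f i <= iter m (killed b) g i.
Proof.
move=> ib fg; elim: m i ib => [|m IH] i ib /=; first exact: fg.
exact: le_killed.
Qed.

Lemma iter_killedZ b c f m i :
  iter m (killed b) (fun j => c * f j) i = c * iter m (killed b) f i.
Proof.
elim: m i => //= m IH i; rewrite -killedZ.
by congr killed; apply/funext => j; rewrite IH.
Qed.

(* The probability that the jump chain avoids [b] at times 1, ..., m. *)
Definition survival b m i : R := iter m (killed b) (fun=> 1) i.

Lemma survival_ge0 b m i : 0 <= survival b m i.
Proof. exact: iter_killed_ge0. Qed.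

Lemma survival_nincr b m i : survival b m.+1 i <= survival b m i.
Proof.
rewrite /survival; elim: m i => [|m IH] i; first exact: killed1_le1.
by apply: le_killed => j _; exact: IH.
Qed.

Lemma survival_le1 b m i : survival b m i <= 1.
Proof. by elim: m => // m; apply: le_trans; exact: survival_nincr. Qed.

Definition mean_hold i : R := (jump_rate Q i)^-1.

Lemma mean_hold_gt0 i : 0 < mean_hold i. Proof. by rewrite invr_gt0. Qed.

Definition mean_upto b m i : R := \sum_(k < m) iter k (killed b) mean_hold i.

Lemma mean_uptoS b m i :
  mean_upto b m.+1 i = mean_hold i + killed b (mean_upto b m) i.
Proof.
rewrite /mean_upto big_ord_recl/= killed_sum.
by congr (_ + _); apply: eq_bigr.
Qed.

(** Unrolls the drift inequality m times. The remainder with V is kept because V may take negative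
    values, and the inequality is only asked off b because [killed] never evaluates V at b. *)
Lemma mean_upto_lyapunov b V m i : i != b ->
  (forall j, j != b -> killed b V j + mean_hold j <= V j) ->
  mean_upto b m i + iter m (killed b) V i <= V i.
Proof.
move=> + VV; elim: m i => [|m IH] i ib; first by rewrite /mean_upto big_ord0 add0r.
rewrite mean_uptoS iterS -addrA -killedD addrC.
by apply: le_trans (VV _ ib); rewrite lerD2r; apply: le_killed => j; exact: IH.
Qed.

Lemma mean_upto_poisson b V m i : i != b ->
  (forall j, j != b -> killed b V j + mean_hold j = V j) ->
  mean_upto b m i + iter m (killed b) V i = V i.
Proof.
move=> + VV; elim: m i => [|m IH] i ib; first by rewrite /mean_upto big_ord0 add0r.
rewrite mean_uptoS iterS -addrA -killedD addrC -[RHS]VV//; congr (_ + _).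
by apply: eq_killed => j; exact: IH.
Qed.

Lemma killed_lyapunov b V i :
  0 <= V b -> generator V i <= -1 -> killed b V i + mean_hold i <= V i.
Proof.
move=> Vb gV; rewrite killedE /mean_hold.
have := ler_wpM2r (ltW (mean_hold_gt0 i)) gV; rewrite /mean_hold mulN1r.
by have := mulr_ge0 (jump_prob_ge0 i b) Vb; lra.
Qed.

Lemma killed_poisson b V i :
  V b = 0 -> generator V i = -1 -> killed b V i + mean_hold i = V i.
Proof. by move=> Vb gV; rewrite killedE /mean_hold gV Vb; lra. Qed.

Lemma abel_sum (c a : nat -> R) m :
  \sum_(j < m.+1) c j * (\sum_(k < j) a k) =
  (\sum_(j < m.+1) c j) * (\sum_(k < m) a k)
  - \sum_(k < m) (\sum_(j < k.+1) c j) * a k.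
Proof.
elim: m => [|m IH]; first by rewrite !big_ord1 /= !big_ord0 subr0.
rewrite big_ord_recr/= IH [\sum_(j < m.+2) c j]big_ord_recr/=.
by rewrite [\sum_(k < m.+1) a k]big_ord_recr/= [X in _ = _ - X]big_ord_recr/=; ring.
Qed.

(** Abel summation against a row of total 0: the partial row sums are [qsum Q n k] for k < n and
    -q_{n,n+1} for k = n. This is why the recursions for F and d involve [qsum]: they make the
    increments of a solution explicit. *)
Lemma generator_sum (a : nat -> R) n : generator (fun j => \sum_(k < j) a k) n =
  Q n n.+1 * a n - \sum_(k < n) qsum Q n k * a k.
Proof.
rewrite /generator abel_sum rate_sum mul0r sub0r big_ord_recr/= opprD addrC.
congr (_ - _).
have := rate_sum n; rewrite big_ord_recr/= => /eqP.
by rewrite addrC addr_eq0 => /eqP ->; rewrite mulNr.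
Qed.

Lemma generatorD f g n :
  generator (fun j => f j + g j) n = generator f n + generator g n.
Proof. by rewrite -big_split; apply: eq_bigr => j _; rewrite mulrDr. Qed.

Lemma generator_cst c n : generator (fun=> c) n = 0.
Proof. by rewrite /generator -mulr_suml rate_sum mul0r. Qed.

Lemma generatorZ c f n : generator (fun j => c * f j) n = c * generator f n.
Proof. by rewrite mulr_sumr; apply: eq_bigr => j _; rewrite mulrCA. Qed.

(** Off-diagonal rates are nonnegative, so a function touched from above at n has the smaller
    generator there. Only values up to n+1 matter. *)
Lemma le_generator f g n : f n = g n ->
  (forall j, (j <= n.+1)%N -> f j <= g j) -> generator f n <= generator g n.
Proof.
move=> fgn fg; apply: ler_sum => j _.
have [->|jn] := eqVneq (j : nat) n; first by rewrite fgn.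
by rewrite ler_wpM2l ?(sb_ge0 Q_sb) ?fg -1?ltnS// eq_sym.
Qed.

Local Notation F := (Fseq Q 0).
Local Notation d := (dseq Q).
Definition sumF n : R := \sum_(k < n) F k.
Definition sumd n : R := \sum_(k < n) d k.

Lemma qsum_ge0 n k : (k < n)%N -> 0 <= qsum Q n k.
Proof.
move=> kn; apply: sumr_ge0 => j _; apply: (sb_ge0 Q_sb).
by rewrite gtn_eqF// (leq_trans (ltn_ord j)).
Qed.

Lemma F_ge0 n : 0 <= F n.
Proof.
elim/ltn_ind: n => -[_|n IH]; first by rewrite Fseqii.
rewrite FseqE// mulr_ge0 ?invr_ge0 ?(ltW (sb_birth Q_sb _))//.
rewrite big_nat sumr_ge0// => k /andP[_ kn].
by rewrite mulr_ge0 ?qsum_ge0 ?IH.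
Qed.

Lemma d_ge0 n : 0 <= d n.
Proof.
elim/ltn_ind: n => -[_|n IH]; first by rewrite dseq0.
rewrite dseqE// mulr_ge0 ?invr_ge0 ?(ltW (sb_birth Q_sb _))//.
rewrite addr_ge0// big_nat sumr_ge0// => k /andP[_ kn].
by rewrite mulr_ge0 ?qsum_ge0 ?IH.
Qed.

Lemma d_gt0 n : 0 < d n.+1.
Proof.
rewrite dseqE// mulr_gt0 ?invr_gt0 ?(sb_birth Q_sb _)//.
rewrite ltr_pwDl// big_nat sumr_ge0// => k /andP[_ kn].
by rewrite mulr_ge0 ?qsum_ge0 ?d_ge0.
Qed.

Lemma generator_sumF n : (0 < n)%N -> generator sumF n = 0.
Proof.
move=> n0; rewrite generator_sum (FseqE _ n0) mulrA divff ?gt_eqF ?(sb_birth Q_sb)//.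
by rewrite mul1r big_mkord subrr.
Qed.

Lemma generator_sumd n : (0 < n)%N -> generator sumd n = 1.
Proof.
move=> n0; rewrite generator_sum (dseqE _ n0) mulrA divff ?gt_eqF ?(sb_birth Q_sb)//.
by rewrite mul1r big_mkord addrK.
Qed.

Lemma sumF1 : sumF 1 = 1. Proof. by rewrite /sumF big_ord1 Fseqii. Qed.
Lemma sumd1 : sumd 1 = 0. Proof. by rewrite /sumd big_ord1 dseq0. Qed.
Lemma sumF0 : sumF 0 = 0. Proof. by rewrite /sumF big_ord0. Qed.
Lemma sumd0 : sumd 0 = 0. Proof. by rewrite /sumd big_ord0. Qed.

Lemma sumF_ge1 n : 1 <= sumF n.+1.
Proof.
by rewrite /sumF big_ord_recl Fseqii lerDl sumr_ge0// => k _; exact: F_ge0.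
Qed.

(** This is the g_c of the overview. *)
Definition poisson_sol c n : R := c * sumF n - sumd n.

Lemma generator_poisson_sol c n : (0 < n)%N -> generator (poisson_sol c) n = -1.
Proof.
move=> n0; have -> : poisson_sol c = fun j => c * sumF j + (-1) * sumd j.
  by apply/funext => j; rewrite mulN1r.
by rewrite generatorD !generatorZ generator_sumF// generator_sumd// mulr0 add0r mulr1.
Qed.

Lemma poisson_sol0 c : poisson_sol c 0 = 0.
Proof. by rewrite /poisson_sol sumF0 sumd0 mulr0 subr0. Qed.

Lemma poisson_sol1 c : poisson_sol c 1 = c.
Proof. by rewrite /poisson_sol sumF1 sumd1 mulr1 subr0. Qed.

(* Skip-freeness upwards makes the equation a recursion for g (n+1). *)
Lemma poisson_sol_unique f : f 0%N = 0 ->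
  (forall n, (0 < n)%N -> generator f n = -1) -> f = poisson_sol (f 1%N).
Proof.
move=> f0 gf; apply/funext; elim/ltn_ind => -[|[|n]] IH.
- by rewrite f0 poisson_sol0.
- by rewrite poisson_sol1.
have : generator f n.+1 = generator (poisson_sol (f 1%N)) n.+1.
  by rewrite gf// generator_poisson_sol.
rewrite /generator big_ord_recr [in RHS]big_ord_recr/=.
under eq_bigr do rewrite IH//.
by move=> /addrI /mulfI; apply; rewrite gt_eqF ?(sb_birth Q_sb).
Qed.

(* [up_time n] is the mean time to climb from 0 to n. *)
Definition up_time n : R := sumd n + (Q 0%N 1%N)^-1 * sumF n.

(** The coefficient of [sumF] is forced by the equation at 0, the only state where [sumF] is not
    harmonic. *)
Lemma generator_up_time n : generator up_time n = 1.
Proof.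
rewrite generatorD generatorZ; case: n => [|n]; last first.
  by rewrite generator_sumF// generator_sumd// mulr0 addr0.
rewrite !generator_sum !big_ord0 dseq0 Fseqii !subr0 mulr0 mulr1 add0r mulVf//.
by rewrite gt_eqF ?(sb_birth Q_sb).
Qed.

Lemma le_up_time m n : (m <= n)%N -> up_time m <= up_time n.
Proof.
move=> mn; have Q01 := sb_birth Q_sb 0%N.
have nd (a : nat -> R) : (forall k, 0 <= a k) -> \sum_(k < m) a k <= \sum_(k < n) a k.
  move=> a0; rewrite -(subnKC mn) big_split_ord/= lerDl.
  by apply: sumr_ge0 => *; exact: a0.
by rewrite lerD// ?ler_wpM2l ?invr_ge0 ?(ltW Q01)//; apply: nd; [exact: d_ge0|exact: F_ge0].
Qed.

End SingleBirth.

(** * Mean return times *)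

Section ereal_approx.
Context {R : realType}.
Implicit Types (x l : \bar R) (u : (\bar R)^nat).
Local Open Scope ereal_scope.

(** Testing against real c allows arguments with the real functions [poisson_sol Q c] even when
    [dlimsup Q] may be infinite. *)
Lemma le_ereal_lt_approx x l : (forall c : R, l < c%:E -> x <= c%:E) -> x <= l.
Proof.
case: l => [r| |] xl; last 2 first.
- exact: leey.
- case: x xl => [s| |] xl //; last by have := xl 0%R (ltNyr _).
  by have := xl (s - 1)%R (ltNyr _); rewrite lee_fin => ?; exfalso; lra.
apply/lee_addgt0Pr => e e0; rewrite -EFinD; apply: xl.
by rewrite lte_fin; lra.
Qed.

Lemma ge_ereal_gt_approx x l : (forall c : R, c%:E < l -> c%:E <= x) -> l <= x.
Proof.
move=> lx; rewrite -leeN2; apply: le_ereal_lt_approx => c.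
by rewrite lteNl leeNl -EFinN; exact: lx.
Qed.

Lemma limn_esup_le u c : (\forall n \near \oo, u n <= c) -> limn_esup u <= c.
Proof.
move=> [N _ uc]; apply: ge_ereal_inf.
exists (ereal_sup [set u n | n in [set n | (N <= n)%N]]).
  by exists [set n | (N <= n)%N] => //; exists N.
by apply: ge_ereal_sup => _ [n /= Nn <-]; exact: uc.
Qed.

Lemma limn_esup_ge u c : (\forall n \near \oo, c <= u n) -> c <= limn_esup u.
Proof.
move=> [N _ uc]; apply: le_ereal_inf_tmp => _ [A [M _ MA] <-].
apply: le_ereal_sup_tmp; exists (u (maxn N M)).
  by exists (maxn N M) => //; apply: MA; exact: leq_maxr.
by apply: uc; exact: leq_maxl.
Qed.

Lemma limn_esup_lt u c : limn_esup u < c -> \forall n \near \oo, u n < c.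
Proof.
move=> /ereal_inf_lt[_ [A [M _ MA] <-]] uc; exists M => // n Mn.
apply: le_lt_trans uc; apply: ereal_sup_ubound; exists n => //; exact: MA.
Qed.

End ereal_approx.

(** * The first-step equation and the constant d *)

Section Recurrence.
Context {R : realType} (Q : nat -> nat -> R) (Q_sb : single_birth Q).
Implicit Types (i j k n m b : nat) (f g V : nat -> R).
Local Notation F := (Fseq Q 0).
Local Notation d := (dseq Q).

Let q_gt0 := jump_rate_gt0 Q_sb.
Let p_ge0 := jump_prob_ge0 Q_sb.

Definition mean_time b i : \bar R :=
  (\sum_(0 <= k <oo) (iter k (killed Q b) (mean_hold Q) i)%:E)%E.

Let iter_mean_ge0 k b i : (0 <= (iter k (killed Q b) (mean_hold Q) i)%:E)%E.
Proof. by rewrite lee_fin iter_killed_ge0// => j; exact/ltW/mean_hold_gt0. Qed.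

Lemma mean_time_ge0 b i : (0 <= mean_time b i)%E.
Proof. exact: nneseries_ge0. Qed.

Lemma mean_upto_sum b m i : (mean_upto Q b m i)%:E =
  (\sum_(0 <= k < m) (iter k (killed Q b) (mean_hold Q) i)%:E)%E.
Proof. by rewrite /mean_upto big_mkord sumEFin. Qed.

Lemma mean_time_le b i (c : R) :
  (forall m, mean_upto Q b m i <= c) -> (mean_time b i <= c%:E)%E.
Proof.
move=> mc; apply: lime_le; first exact: is_cvg_nneseries.
by apply: nearW => m; rewrite -mean_upto_sum lee_fin.
Qed.

Lemma mean_upto_nd b i : {homo (fun m => mean_upto Q b m i) : m n / (m <= n)%N >-> m <= n}.
Proof.
move=> m n mn; rewrite -lee_fin !mean_upto_sum.
by rewrite lee_sum_nneg_natr.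
Qed.

Lemma mean_timeE b i : mean_time b i = ((mean_hold Q i)%:E +
  \sum_(j < i.+2 | nat_of_ord j != b) (jump_prob Q i j)%:E * mean_time b j)%E.
Proof.
rewrite {1}/mean_time nneseries_recl//=; congr (_ + _)%E.
rewrite -(nneseries_addn 1)//.
under eq_eseriesr do rewrite addn1 /= -sumEFin.
rewrite nneseries_sum; last first.
  by move=> j k _; rewrite lee_fin mulr_ge0// -lee_fin.
apply: eq_bigr => j _; rewrite -nneseriesZl//.
Qed.

(** One way to avoid b for m+1 steps from n is to jump to n+1 and avoid b for m steps from there. *)
Lemma survival_succ b m n : n.+1 != b ->
  survival Q b m n.+1 <= (jump_prob Q n n.+1)^-1 * survival Q b m.+1 n.
Proof.
move=> nb; rewrite ler_pdivlMl ?jump_prob_succ_gt0// {2}/survival iterS /killed.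
rewrite (bigD1 (Ordinal (ltnSn n.+1)))//= lerDl sumr_ge0// => j _.
by rewrite mulr_ge0 ?survival_ge0.
Qed.

(** Recurrence as seen by the killed kernel alone, with no reference to trajectories: the jump chain
    reaches 0 almost surely from every state. *)
Definition certain_hit := forall i, survival Q 0 m i @[m --> \oo] --> 0.

Lemma certain_hit_from0 : survival Q 0 m 0%N @[m --> \oo] --> 0 -> certain_hit.
Proof.
move=> s0; elim=> // n IH.
apply: (@squeeze_cvgr _ _ _ _ (fun=> 0) (fun m => (jump_prob Q n n.+1)^-1 * survival Q 0 m.+1 n)).
- by apply: nearW => m; rewrite survival_ge0//= survival_succ.
- exact: cvg_cst.
- rewrite -(mulr0 ((jump_prob Q n n.+1)^-1)); apply: cvgMr.
  by rewrite (cvg_shiftS (fun m => survival Q 0 m n)).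
Qed.

Lemma dlimsup_ge0 : (0 <= dlimsup Q)%E.
Proof.
apply: limn_esup_ge; apply: nearW => n.
by rewrite lee_fin divr_ge0//; apply: sumr_ge0 => k _; [exact: d_ge0|exact: F_ge0].
Qed.

(** The origin of the quotient in [dlimsup]: it is the smallest c for which g_c is nonnegative at
    n+1. *)
Lemma poisson_sol_ge0 c n :
  (0 <= poisson_sol Q c n.+1) = (sumd Q n.+1 / sumF Q n.+1 <= c).
Proof.
by rewrite ler_pdivrMr ?subr_ge0// (lt_le_trans ltr01)// sumF_ge1.
Qed.

(** For c > d the function g_c is eventually nonnegative, and the finitely many earlier values are
    absorbed in C. *)
Lemma poisson_sol_bounded_below c : (dlimsup Q < c%:E)%E ->
  exists2 C, 0 <= C & forall n, - C <= poisson_sol Q c n.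
Proof.
move=> /limn_esup_lt[N _ Nc].
exists (\sum_(k < N.+1) `|poisson_sol Q c k|); first exact: sumr_ge0.
move=> n; have [nN|] := ltnP n N.+1.
  rewrite (bigD1 (Ordinal nN))//= opprD.
  have : 0 <= \sum_(k < N.+1 | k != Ordinal nN) `|poisson_sol Q c k| by exact: sumr_ge0.
  by have := lerNnormlW (lexx `|poisson_sol Q c n|); lra.
case: n => // n Nn; apply: (@le_trans _ _ 0).
  by rewrite oppr_le0 sumr_ge0.
by rewrite poisson_sol_ge0 -lee_fin ltW// Nc.
Qed.

Lemma mean_upto_le_poisson c m i : (0 < i)%N ->
  mean_upto Q 0 m i + iter m (killed Q 0) (poisson_sol Q c) i = poisson_sol Q c i.
Proof.
move=> i0; apply: mean_upto_poisson; first by rewrite -lt0n.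
move=> j j0; apply: killed_poisson => //; first exact: poisson_sol0.
by rewrite generator_poisson_sol// lt0n.
Qed.

Lemma iter_killed_ge c C m i : (0 < i)%N -> (forall n, - C <= poisson_sol Q c n) ->
  - (C * survival Q 0 m i) <= iter m (killed Q 0) (poisson_sol Q c) i.
Proof.
move=> i0 gC; rewrite -mulNr -iter_killedZ; apply: le_iter_killed => //.
  by rewrite -lt0n.
by move=> j _; rewrite mulr1.
Qed.

(** Bounding the survival probability by 1 gives a crude but finite estimate. It serves under
    non-explosion, before the return to 0 is known to be certain. *)
Lemma mean_time_dlimsup c i : (dlimsup Q < c%:E)%E -> (0 < i)%N ->
  (mean_time 0 i < +oo)%E.
Proof.
move=> /poisson_sol_bounded_below[C C0 gC] i0.
apply: (@le_lt_trans _ _ (poisson_sol Q c i + C)%:E); last exact: ltry.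
apply: mean_time_le => m; rewrite -(mean_upto_le_poisson c m i0).
have := iter_killed_ge m i0 gC; have := survival_le1 Q_sb 0 m i.
by move=> /(ler_wpM2l C0); lra.
Qed.

(** With m fixed, the time up to m jumps is at most the time up to n >= m jumps, which is at most
    g_c plus C times the survival probability; then n tends to infinity. *)
Lemma mean_time_le_poisson c i : certain_hit -> (dlimsup Q < c%:E)%E ->
  (0 < i)%N -> (mean_time 0 i <= (poisson_sol Q c i)%:E)%E.
Proof.
move=> hit /poisson_sol_bounded_below[C C0 gC] i0; apply: mean_time_le => m.
apply: (@ler_cvg_to _ \oo _ _ (fun=> mean_upto Q 0 m i)
  (fun n => poisson_sol Q c i + C * survival Q 0 n i)).
- exact: cvg_cst.
- rewrite -[X in _ --> X]addr0 -(mulr0 C); apply: cvgD; first exact: cvg_cst.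
  by apply: cvgMr; exact: hit.
- exists m => // n /= mn; apply: le_trans (mean_upto_nd 0 i mn) _.
  rewrite -(mean_upto_le_poisson c n i0).
  by have := iter_killed_ge n i0 gC; lra.
Qed.

(* The first-step equation [mean_timeE] read backwards. *)
Lemma mean_time_step n j : (n != 0)%N -> (mean_time 0 n < +oo)%E ->
  (j != 0)%N -> 0 < jump_prob Q n j -> (mean_time 0 j < +oo)%E.
Proof.
move=> n0 + j0 nj; rewrite mean_timeE ltNge leye_eq => /eqP h.
rewrite ltNge leye_eq; apply/eqP => yj; apply: h.
have jn : (j < n.+2)%N.
  by rewrite ltnNge; apply: contraTN nj => nj; rewrite jump_prob_up2 ?ltxx.
rewrite (bigD1 (Ordinal jn))//= yj gt0_muley ?lte_fin// addye ?addey//.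
rewrite gt_eqF// (lt_le_trans ltNy0)// sume_ge0// => k _.
by rewrite mule_ge0 ?mean_time_ge0 ?lee_fin.
Qed.

(** The value at 0 is the boundary value of Poisson's equation, not the mean return time from 0. An
    infinite mean time is sent to 0 by [fine]. *)
Definition mean_time_real i : R := if i == 0%N then 0 else fine (mean_time 0 i).

Lemma mean_time_real_ge0 i : 0 <= mean_time_real i.
Proof. by rewrite /mean_time_real; case: ifP => // _; rewrite fine_ge0// mean_time_ge0. Qed.

Lemma mean_time_realE n : (n != 0)%N -> (mean_time 0 n < +oo)%E ->
  mean_time_real n = mean_hold Q n + killed Q 0 mean_time_real n.
Proof.
move=> n0 yn; rewrite {1}/mean_time_real (negbTE n0).
have yE : (mean_time 0 n = (mean_hold Q n + killed Q 0 mean_time_real n)%:E)%E.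
  rewrite mean_timeE EFinD; congr (_ + _)%E; rewrite -sumEFin.
  apply: eq_bigr => j j0; rewrite EFinM /mean_time_real (negbTE j0).
  have [->|nj] := eqVneq (jump_prob Q n j) 0; first by rewrite !mul0e.
  rewrite fineK// ge0_fin_numE ?mean_time_ge0//.
  by apply: (mean_time_step n0 yn j0); rewrite lt_def nj p_ge0.
by rewrite yE.
Qed.

(* The states with a finite mean time are closed upwards.  The Lyapunov function
   is the mean time on them and, off 0, [C + up_time n - up_time l] on the
   states l that remain; C dominates the mean times from the states up to n. *)
Lemma mean_time1_fin n : (0 < n)%N -> (mean_time 0 n < +oo)%E -> (mean_time 0 1 < +oo)%E.
Proof.
move=> n0 yn; pose S j := (mean_time 0 j < +oo)%E.
have upS k : S (n + k)%N.
  elim: k => [|k IH]; first by rewrite addn0.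
  by rewrite addnS; apply: (mean_time_step _ IH) => //; [lia|exact: jump_prob_succ_gt0].
pose C : R := \sum_(l < n.+1) mean_time_real l.
pose Z l := C + up_time Q n - up_time Q l.
pose W j := if j == 0%N then 0 else if S j then mean_time_real j else Z j.
have WZ j l : (j < n)%N -> (l <= j.+1)%N -> W l <= Z l.
  move=> jn lj; have ln : (l <= n)%N by lia.
  have := le_up_time Q_sb ln; have C0 : 0 <= C by apply: sumr_ge0 => *; exact: mean_time_real_ge0.
  rewrite /W /Z; case: ifP => _ upl; first by lra.
  case: ifP => // _; have : mean_time_real l <= C; last by lra.
  have ln1 : (l < n.+1)%N by [].
  rewrite /C (bigD1 (Ordinal ln1))//= lerDl sumr_ge0// => *; exact: mean_time_real_ge0.
have WL j : j != 0%N -> killed Q 0 W j + mean_hold Q j <= W j.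
  move=> j0; have [Sj|nSj] := boolP (S j).
    rewrite {2}/W (negbTE j0) Sj mean_time_realE// addrC lerD2l.
    apply: ler_sum => k k0; have [->|jk] := eqVneq (jump_prob Q j k) 0; first by rewrite !mul0r.
    rewrite /W (negbTE k0); suff -> : S k by [].
    by apply: (mean_time_step j0 Sj k0); rewrite lt_def jk p_ge0.
  have jn : (j < n)%N.
    by rewrite ltnNge; apply: contra nSj => nj; rewrite -(subnKC nj).
  (* At a remaining state j, W agrees with Z and lies below it up to j+1, so its generator is at
     most that of Z, which is -1. *)
  apply: (killed_lyapunov Q_sb) => //.
  have gZ : generator Q Z j = -1.
    have -> : Z = fun l => (C + up_time Q n) + (-1) * up_time Q l.
      by apply/funext => l; rewrite /Z; ring.
    by rewrite (generatorD _ (fun=> _)) generatorZ (generator_cst Q_sb) (generator_up_time Q_sb) add0r mulr1.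
  rewrite -gZ; apply: (le_generator Q_sb); last by move=> l; exact: WZ.
  by rewrite /W (negbTE j0) (negbTE nSj).
have W0 j : 0 <= W j.
  rewrite /W; case: ifP => // j0; case: ifP => [_|/negbT nSj]; first exact: mean_time_real_ge0.
  have jn : (j <= n)%N.
    by rewrite leqNgt; apply: contra nSj => /ltnW nj; rewrite -(subnKC nj).
  have := le_up_time Q_sb jn; have C0 : 0 <= C by apply: sumr_ge0 => *; exact: mean_time_real_ge0.
  by rewrite /Z; lra.
apply: (@le_lt_trans _ _ (W 1%N)%:E); last exact: ltry.
apply: mean_time_le => m.
have := mean_upto_lyapunov Q_sb m (isT : 1%N != 0%N) WL.
by have := iter_killed_ge0 Q_sb 0 m 1 W0; lra.
Qed.

Lemma mean_time_real_poisson : (mean_time 0 1 < +oo)%E ->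
  mean_time_real = poisson_sol Q (fine (mean_time 0 1)).
Proof.
move=> y1; have yfin n : (mean_time 0 n.+1 < +oo)%E.
  elim: n => // n IH; apply: (mean_time_step _ IH) => //; exact: jump_prob_succ_gt0.
apply: (@poisson_sol_unique _ Q Q_sb) => // -[//|n] _.
have := mean_time_realE (isT : n.+1 != 0%N) (yfin n).
rewrite killedE// mulr0 subr0 /mean_hold => h.
have /eqP : (1 + generator Q mean_time_real n.+1) * (jump_rate Q n.+1)^-1 = 0.
  by rewrite mulrDl mul1r; lra.
by rewrite mulf_eq0 invr_eq0 (gt_eqF (q_gt0 _)) orbF => /eqP; lra.
Qed.

Lemma dlimsup_le_mean_time : (dlimsup Q <= mean_time 0 1)%E.
Proof.
have [->|y1] := eqVneq (mean_time 0 1) +oo%E; first exact: leey.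
rewrite -ltey in y1; have yE := mean_time_real_poisson y1.
rewrite -[leRHS]fineK ?ge0_fin_numE ?mean_time_ge0//.
apply: limn_esup_le; apply: nearW => n; rewrite lee_fin -poisson_sol_ge0 -yE.
exact: mean_time_real_ge0.
Qed.

Lemma mean_time1E : certain_hit -> mean_time 0 1 = dlimsup Q.
Proof.
move=> hit; apply/eqP; rewrite eq_le dlimsup_le_mean_time andbT.
apply: le_ereal_lt_approx => c dc.
by have := mean_time_le_poisson hit dc (ltn0Sn 0); rewrite poisson_sol1.
Qed.

Lemma sum_poisson_sol (c : R) n : (\sum_(k < n) ((F k)%:E * c%:E - (d k)%:E))%E = (poisson_sol Q c n)%:E.
Proof.
under eq_bigr do rewrite -EFinM -EFinB.
rewrite sumEFin sumrB; congr (_ - _)%:E.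
by rewrite mulr_sumr; apply: eq_bigr => k _; rewrite mulrC.
Qed.

(** The term k = 0 is +oo since F_0 = 1 and d_0 = 0. The others are +oo, or the finite -d_k when F_k
    = 0 by the convention 0 * oo = 0, so no term is -oo. *)
Lemma sum_poisson_sol_pinfty n :
  (\sum_(k < n.+1) ((F k)%:E * +oo - (d k)%:E) = +oo :> \bar R)%E.
Proof.
rewrite big_ord_recl Fseqii mul1e dseq0 sube0 addye//.
elim/big_ind : _ => // [x y xy yy|k _]; first by rewrite adde_eq_ninfty negb_or xy.
have := F_ge0 Q_sb (lift ord0 k); rewrite le_eqVlt => /predU1P[<-|F0].
  by rewrite mul0e add0e.
by rewrite gt0_muley ?lte_fin.
Qed.

Lemma mean_time0E : mean_time 0 0 = ((Q 0%N 1%N)^-1%:E + mean_time 0 1)%E.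
Proof.
have q0 : jump_rate Q 0 = Q 0%N 1%N.
  have := rate_sum Q_sb 0; rewrite !big_ord_recr big_ord0/= add0r /jump_rate.
  by lra.
rewrite mean_timeE /mean_hold q0 (bigD1 (Ordinal (ltnSn 1)))//= big1 ?adde0.
  by rewrite /jump_prob/= q0 divff ?gt_eqF ?(sb_birth Q_sb)// mul1e.
by move=> [[|[|j]]].
Qed.

Lemma mean_timeSE n : certain_hit -> mean_time 0 n.+1 =
  (\sum_(k < n.+1) ((F k)%:E * dlimsup Q - (d k)%:E))%E.
Proof.
move=> hit; have y1 := mean_time1E hit.
have [dy|dy] := eqVneq (dlimsup Q) +oo%E.
  (* With d infinite, m_0(1) is infinite; a finite m_0(n+1) would contradict this by
     [mean_time1_fin]. *)
  rewrite dy sum_poisson_sol_pinfty; apply/eqP; rewrite -leye_eq leNgt.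
  by apply/negP => /mean_time1_fin; rewrite y1 dy ltxx => /(_ isT).
have y1fin : (mean_time 0 1 < +oo)%E by rewrite y1 ltey.
have yE := mean_time_real_poisson y1fin.
have yfin : (mean_time 0 n.+1 < +oo)%E.
  elim: n => // n IH; apply: (mean_time_step _ IH) => //; exact: jump_prob_succ_gt0.
rewrite -y1 -[mean_time 0 1]fineK ?ge0_fin_numE ?mean_time_ge0//.
rewrite sum_poisson_sol -yE /mean_time_real/= fineK// ge0_fin_numE ?mean_time_ge0//.
Qed.

Lemma sumFS n : sumF Q n.+1 = sumF Q n + F n. Proof. exact: big_ord_recr. Qed.
Lemma sumdS n : sumd Q n.+1 = sumd Q n + d n. Proof. exact: big_ord_recr. Qed.

Lemma sumF_nd m n : (m <= n)%N -> sumF Q m <= sumF Q n.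
Proof.
move=> mn; rewrite /sumF -(subnKC mn) big_split_ord/= lerDl.
by apply: sumr_ge0 => k _; exact: F_ge0.
Qed.

(* A bounded [sumF] would be a bounded harmonic function vanishing at 0 only. *)
Lemma sumF_unbounded K : certain_hit -> \forall n \near \oo, K < sumF Q n.
Proof.
move=> hit; suff [N KN] : exists N, K < sumF Q N.
  by exists N => // n /= Nn; apply: lt_le_trans KN (sumF_nd Nn).
apply: contrapT => nK; have FK n : sumF Q n <= K * 1.
  by rewrite mulr1 leNgt; apply/negP => Kn; apply: nK; exists n.
(* Off 0 the killed kernel fixes [sumF], which is harmonic there and vanishes at 0. Iterating on the
   bound by K therefore compares [sumF Q 1 = 1] with K times a vanishing survival probability. *)
have Fm m : 1 <= K * survival Q 0 m 1.
  rewrite -iter_killedZ -[leLHS](sumF1 Q).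
  apply: (@le_trans _ _ (iter m (killed Q 0) (sumF Q) 1)); last exact: le_iter_killed.
  suff h : forall i, i != 0%N -> iter m (killed Q 0) (sumF Q) i = sumF Q i by rewrite h.
  elim: m => // m IH i i0 /=; rewrite (@eq_killed _ Q 0 _ (sumF Q))//.
  by rewrite killedE// sumF0 mulr0 subr0 generator_sumF ?lt0n// mul0r addr0.
have : 1 <= K * 0 :> R.
  apply: (@ler_cvg_to _ \oo _ _ (fun=> 1) (fun m => K * survival Q 0 m 1)).
  - exact: cvg_cst.
  - by apply: cvgMr; exact: hit.
  - exact: nearW.
by rewrite mulr0 ler10.
Qed.

(** A Stolz-Cesaro argument in both directions: the divergence of [sumF] makes the contribution C of
    the first terms negligible in the quotient. *)
Lemma dratio_limE l : certain_hit -> dratio Q n @[n --> \oo] --> l -> dlimsup Q = l.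
Proof.
move=> hit dl; apply/eqP; rewrite eq_le; apply/andP; split.
  apply: le_ereal_lt_approx => c lc.
  have [N _ Nc] : \forall n \near \oo, (dratio Q n < c%:E)%E.
    apply: (dl [set x | (x < c%:E)%E]); apply: open_nbhs_nbhs; split => //.
    exact: open_ereal_lt_ereal.
  (* F_n = 0 would make the ratio +oo, as d_n > 0 for n >= 1, against the bound by c. *)
  have dF n : (N < n)%N -> d n <= c * F n.
    case: n => // n Nn; have := Nc n.+1 (ltnW Nn); rewrite /= /dratio.
    rewrite inver; case: eqP => [_|/eqP F0]; first by rewrite gt0_muley ?lte_fin ?d_gt0.
    have F0' : 0 < F n.+1 by rewrite lt_def F0 F_ge0.
    by rewrite -EFinM lte_fin ltr_pdivrMr// => /ltW.
  have dF' n : sumd Q (N.+1 + n) <= c * sumF Q (N.+1 + n) + (sumd Q N.+1 - c * sumF Q N.+1).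
    elim: n => [|n IH]; first by rewrite addn0; lra.
    rewrite addnS (sumdS (N.+1 + n)) (sumFS (N.+1 + n)).
    by have := dF (N.+1 + n)%N (leq_addr _ _); lra.
  set C := sumd Q N.+1 - c * sumF Q N.+1 in dF'.
  apply/lee_addgt0Pr => e e0; rewrite -EFinD; apply: limn_esup_le.
  have [M _ MC] := sumF_unbounded (`|C| / e) hit.
  exists (maxn M N.+1) => // n /=; rewrite geq_max => /andP[Mn Nn].
  rewrite lee_fin ler_pdivrMr; last exact: lt_le_trans ltr01 (sumF_ge1 _ _).
  have := dF' (n.+1 - N.+1)%N; rewrite subnKC; last exact: leqW.
  move=> /le_trans; apply; rewrite mulrDl lerD2l (le_trans (ler_norm _))//.
  by have := MC n.+1 (leqW Mn); rewrite /= ltr_pdivrMr// mulrC => /ltW.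
apply: ge_ereal_gt_approx => c lc.
have [N _ Nc] : \forall n \near \oo, (c%:E < dratio Q n)%E.
  apply: (dl [set x | (c%:E < x)%E]); apply: open_nbhs_nbhs; split => //.
  exact: open_ereal_gt_ereal.
have dF n : (N < n)%N -> c * F n <= d n.
  case: n => // n Nn; have := Nc n.+1 (ltnW Nn); rewrite /= /dratio.
  rewrite inver; case: eqP => [->|/eqP F0]; first by rewrite mulr0 d_ge0.
  have F0' : 0 < F n.+1 by rewrite lt_def F0 F_ge0.
  by rewrite -EFinM lte_fin ltr_pdivlMr// => /ltW.
have dF' n : c * sumF Q (N.+1 + n) - (c * sumF Q N.+1 - sumd Q N.+1) <= sumd Q (N.+1 + n).
  elim: n => [|n IH]; first by rewrite addn0; lra.
  rewrite addnS (sumdS (N.+1 + n)) (sumFS (N.+1 + n)).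
  by have := dF (N.+1 + n)%N (leq_addr _ _); lra.
set C := c * sumF Q N.+1 - sumd Q N.+1 in dF'.
apply/lee_subgt0Pr => e e0; rewrite -EFinB; apply: limn_esup_ge.
have [M _ MC] := sumF_unbounded (`|C| / e) hit.
exists (maxn M N.+1) => // n /=; rewrite geq_max => /andP[Mn Nn].
rewrite lee_fin ler_pdivlMr; last exact: lt_le_trans ltr01 (sumF_ge1 _ _).
have := dF' (n.+1 - N.+1)%N; rewrite subnKC; last exact: leqW.
apply: le_trans; rewrite mulrBl lerD2l lerN2 (le_trans (ler_norm _))//.
by have := MC n.+1 (leqW Mn); rewrite /= ltr_pdivrMr// mulrC => /ltW.
Qed.

(* The Lyapunov function bounds the mean time to climb to b from below b and, from
   above b, the mean time to come down to 0 plus that to climb from 0 to b. *)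
Lemma mean_return_time_fin b : certain_hit -> (dlimsup Q < +oo)%E ->
  (mean_time b b < +oo)%E.
Proof.
move=> hit dfin; have y1 : (mean_time 0 1 < +oo)%E by rewrite mean_time1E.
have fE := mean_time_real_poisson y1.
have gf n : (0 < n)%N -> generator Q mean_time_real n = -1.
  by move=> n0; rewrite fE generator_poisson_sol.
have f0 := mean_time_real_ge0.
have up0 n : 0 <= up_time Q n.
  have := le_up_time Q_sb (leq0n n).
  by rewrite {1}/up_time sumd0 sumF0 mulr0 addr0.
pose V j := if (j < b)%N then up_time Q b - up_time Q j
  else if j == b then 0 else mean_time_real j + up_time Q b.
have V0 j : 0 <= V j.
  rewrite /V; case: ifP => [/ltnW/(le_up_time Q_sb)|_]; first by rewrite subr_ge0.
  by case: ifP => // _; rewrite addr_ge0.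
have VL j : j != b -> killed Q b V j + mean_hold Q j <= V j.
  move=> jb; apply: (killed_lyapunov Q_sb) => //.
  have [jltb|bj] := ltnP j b.
    have -> : -1 = generator Q (fun l => up_time Q b + (-1) * up_time Q l) j.
      by rewrite (generatorD _ (fun=> _)) generatorZ (generator_cst Q_sb) (generator_up_time Q_sb) add0r mulr1.
    (* From j < b one jump reaches at most b, where both functions vanish, so the two agree on all
       relevant states. *)
    apply: (le_generator Q_sb); first by rewrite /V jltb mulN1r.
    move=> l lj; rewrite /V mulN1r; case: ltnP => [//|bl].
    by have -> : l = b by [lia]; rewrite eqxx subrr.
  have {}bj : (b < j)%N by rewrite ltn_neqAle eq_sym jb.
  rewrite -(gf j); last by lia.
  have -> : generator Q mean_time_real j = generator Q (fun l => mean_time_real l + up_time Q b) j.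
    by rewrite (generatorD _ _ (fun=> _)) (generator_cst Q_sb) addr0.
  (* Here V is compared with m_0 + [up_time Q b], which it equals above b and does not exceed
     elsewhere; adding a constant leaves the generator at -1. *)
  apply: (le_generator Q_sb).
    by rewrite /V (negbTE jb) ltnNge ltnW.
  move=> l _; rewrite /V; case: ifP => _; first by have := f0 l; have := up0 l; lra.
  by case: ifP => // _; rewrite addr_ge0.
have mV m j : j != b -> mean_upto Q b m j <= V j.
  move=> jb; have := mean_upto_lyapunov Q_sb m jb VL.
  by have := iter_killed_ge0 Q_sb b m j V0; lra.
(* The drift inequality holds only off b, so the first step from b is unrolled by hand. *)
apply: (@le_lt_trans _ _ (mean_hold Q b + killed Q b V b)%:E); last exact: ltry.
apply: mean_time_le => -[|m].
  rewrite /mean_upto big_ord0 addr_ge0 ?killed_ge0//.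
  exact/ltW/mean_hold_gt0.
by rewrite mean_uptoS lerD2l; apply: le_killed => // j; exact: mV.
Qed.

End Recurrence.

(** * Trajectories and their law *)

Section Cylinders.
Context {R : realType}.
Local Notation traj := (nat -> nat * R).
Implicit Types (y : nat -> nat) (t : nat -> R) (n k : nat) (z : traj).

Definition cylinder n y t : set traj :=
  [set z | forall k, (k <= n)%N -> (z k).1 = y k /\ t k < (z k).2].

(** The empty set is included to obtain a pi-system: cylinders that prescribe different states at
    some time are disjoint. *)
Definition cylinders n : set (set traj) :=
  [set C | C = set0 \/ exists y t, C = cylinder n y t].

(** The sigma-algebra of the first n+1 states and durations. All horizons share the carrier of
    infinite trajectories, so an event can be reused at any sufficient horizon. *)
Definition horizon n := g_sigma_algebraType (cylinders n).

Lemma measurable_cylinder n y t : measurable (cylinder n y t : set (horizon n)).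
Proof. by apply: sub_sigma_algebra; right; exists y, t. Qed.

Let cyl_at n k (a : R) (p : seq nat * nat) :=
  cylinder n (nth 0%N p.1) (fun l => if l == k then a else - p.2%:R).

(** A condition on coordinate k alone is a countable union of cylinders: the remaining states run
    through finite words, and the thresholds of the remaining durations are negatives of
    integers. *)
Let cover n k (P : set nat) (a : R) : (k <= n)%N ->
  [set z : traj | P (z k).1 /\ a < (z k).2] =
  \bigcup_(p : seq nat * nat) if `[< P (nth 0%N p.1 k) >] then cyl_at n k a p else set0.
Proof.
move=> kn; apply/seteqP; split=> z /=; last first.
  move=> [p _]; case: asboolP => // Pp /(_ k kn); rewrite eqxx => -[zk ak].
  by rewrite zk.
move=> [Pz az].
pose M := \sum_(l < n.+1) `|(z l).2|.
exists (mkseq (fun l => (z l).1) n.+1, Num.bound M) => //=.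
have zE l : (l <= n)%N -> nth 0%N (mkseq (fun l => (z l).1) n.+1) l = (z l).1.
  by move=> ln; rewrite nth_mkseq.
case: asboolP => [_|]; last by rewrite zE.
move=> l ln /=; rewrite zE//; split => //; case: eqP => [->//|_].
rewrite ltrNl (le_lt_trans (ler_norm _))// normrN.
apply: (@le_lt_trans _ _ M); last by apply: archi_boundP; exact: sumr_ge0.
have ln1 : (l < n.+1)%N by [].
by rewrite /M (bigD1 (Ordinal ln1))//= lerDl sumr_ge0.
Qed.

Let measurable_cover n k (P : set nat) (a : R) : (k <= n)%N ->
  measurable ([set z | P (z k).1 /\ a < (z k).2] : set (horizon n)).
Proof.
move=> kn; rewrite (cover _ _ kn); apply: countable_bigcupT_measurable.
  exact: countableP.
by move=> p; case: asboolP => // _; exact: measurable_cylinder.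
Qed.

Lemma measurable_state n k : (k <= n)%N ->
  measurable_fun setT (fun z : horizon n => (z k).1).
Proof.
move=> kn _ P _; rewrite setTI.
rewrite [X in measurable X](_ : _ = \bigcup_m [set z : traj | P (z k).1 /\ - m%:R < (z k).2]).
  by apply: bigcupT_measurable => m; exact: measurable_cover.
apply/seteqP; split=> z /=; last by case=> m _ [].
move=> Pz; exists (Num.bound `|(z k).2|) => //; split => //.
rewrite ltrNl (le_lt_trans (ler_norm _))// normrN; exact: archi_boundP.
Qed.

Lemma measurable_duration n k : (k <= n)%N ->
  measurable_fun setT (fun z : horizon n => (z k).2).
Proof.
move=> kn; apply: (measurability _ (RGenOInfty.measurableE R)) => //.
move=> _ [_ [a ->] <-]; rewrite setTI.
rewrite [X in measurable X](_ : _ = [set z : traj | [set: nat] (z k).1 /\ a < (z k).2]).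
  exact: measurable_cover.
by apply/seteqP; split => z /=; rewrite in_itv/= andbT// => -[].
Qed.

Lemma measurable_traj d (O : measurableType d) n (Z : O -> traj) :
  (forall k, (k <= n)%N -> measurable_fun setT (fun w => (Z w k).1)) ->
  (forall k, (k <= n)%N -> measurable_fun setT (fun w => (Z w k).2)) ->
  measurable_fun setT (Z : O -> horizon n).
Proof.
move=> mZ1 mZ2; apply: (@measurability _ _ _ (horizon n) _ _ (cylinders n)) => //.
move=> _ [_ [->|[y [t ->]]] <-]; rewrite setTI; first by rewrite preimage_set0.
rewrite [X in measurable X](_ : _ = \bigcap_(k in [set k | (k <= n)%N])
  ([set w | (Z w k).1 = y k] `&` [set w | t k < (Z w k).2])); last first.
  by apply/seteqP; split => w.
apply: bigcap_measurableType => k /= kn; apply: measurableI.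
  by rewrite -[X in measurable X]setTI; apply: (mZ1 k kn measurableT [set y k]).
rewrite -[X in measurable X]setTI [X in _ `&` X](_ : _ = (fun w => (Z w k).2) @^-1` `]t k, +oo[).
  exact: mZ2.
by apply/seteqP; split => w /=; rewrite in_itv/= andbT.
Qed.

Section RestrictedLaw.
Context d (O : measurableType d) (m : {measure set O -> \bar R}) (B : set O)
  (mB : measurable B) n (Z : O -> traj) (mZ : measurable_fun setT (Z : O -> horizon n)).

(** Taking the measurability proof as an argument lets the measure structure be inferred from the
    term. *)
Definition restricted_law of measurable_fun setT (Z : O -> horizon n) :=
  fun D : set (horizon n) => mrestr m mB (Z @^-1` D).

Let mZ' (D : set (horizon n)) : measurable D -> measurable (Z @^-1` D).
Proof. by move=> mD; rewrite -[X in measurable X]setTI; exact: mZ. Qed.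

Let restricted_law0 : restricted_law mZ set0 = 0%E.
Proof. by rewrite /restricted_law preimage_set0 measure0. Qed.

Let restricted_law_ge0 D : (0 <= restricted_law mZ D)%E.
Proof. exact: measure_ge0. Qed.

Let restricted_law_sigma_additive : semi_sigma_additive (restricted_law mZ).
Proof.
move=> F mF tF mUF; rewrite /restricted_law preimage_bigcup.
apply: measure_semi_sigma_additive.
- by move=> i; exact: mZ'.
- apply/trivIsetP => /= i j _ _ ij; rewrite -preimage_setI.
  by move/trivIsetP : tF => /(_ _ _ _ _ ij) ->//; rewrite preimage_set0.
- by rewrite -preimage_bigcup; exact: mZ'.
Qed.

HB.instance Definition _ := isMeasure.Build _ _ _ (restricted_law mZ)
  restricted_law0 restricted_law_ge0 restricted_law_sigma_additive.

End RestrictedLaw.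

(** The pi-lambda theorem in the form needed for Markov properties: the factor c is the probability
    of the conditioning event, and cylinders with nonnegative thresholds suffice because the
    durations are positive on [B1] and [B2]. *)
Lemma law_unique d1 d2 (O1 : measurableType d1) (O2 : measurableType d2)
  (m1 : probability O1 R) (m2 : probability O2 R)
  n (Z1 : O1 -> traj) (Z2 : O2 -> traj) (B1 : set O1) (B2 : set O2) (c : R) :
  measurable B1 -> measurable B2 ->
  measurable_fun setT (Z1 : O1 -> horizon n) ->
  measurable_fun setT (Z2 : O2 -> horizon n) -> 0 <= c ->
  (forall w k, B1 w -> (k <= n)%N -> 0 < (Z1 w k).2) ->
  (forall w k, B2 w -> (k <= n)%N -> 0 < (Z2 w k).2) ->
  (forall y t, (forall k, 0 <= t k) ->
    m1 (B1 `&` Z1 @^-1` cylinder n y t) =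
      (c%:E * m2 (B2 `&` Z2 @^-1` cylinder n y t))%E) ->
  forall D : set (horizon n), measurable D ->
    m1 (B1 `&` Z1 @^-1` D) = (c%:E * m2 (B2 `&` Z2 @^-1` D))%E.
Proof.
move=> mB1 mB2 mZ1 mZ2 c0 pos1 pos2 m12 D mD.
pose nu1 := restricted_law m1 mB1 mZ1.
pose nu2 := mscale (NngNum c0) (restricted_law m2 mB2 mZ2).
have nu1E A : nu1 A = m1 (B1 `&` Z1 @^-1` A) by rewrite setIC.
have nu2E A : nu2 A = (c%:E * m2 (B2 `&` Z2 @^-1` A))%E by rewrite setIC.
suff : nu1 D = nu2 D by rewrite nu1E nu2E.
have cylI : setI_closed (cylinders n).
  move=> _ _ [->|[y [t ->]]] [->|[y' [t' ->]]]; rewrite ?set0I ?setI0; try by left.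
  have [yy'|yy'] := pselect (forall k, (k <= n)%N -> y k = y' k); last first.
    left; apply/seteqP; split => // z [h h']; apply: yy' => k kn.
    by have [<- _] := h k kn; have [-> _] := h' k kn.
  right; exists y, (fun k => Num.max (t k) (t' k)); apply/seteqP; split => z /=.
    move=> [h h'] k kn; have [zk tk] := h k kn; have [_ tk'] := h' k kn.
    by rewrite gt_max tk tk'.
  move=> h; split => k kn; have [zk] := h k kn; rewrite gt_max => /andP[tk tk'].
    by [].
  by rewrite zk yy'.
(* A countable cover of the whole space by members of the pi-system. Its thresholds are negative,
   since points of [horizon n] may have negative durations. *)
pose g i := if unpickle i is Some p then
  cylinder n (nth 0%N (p : seq nat * nat).1) (fun=> - p.2%:R) else set0.
apply: (@measure_unique _ _ (horizon n) (cylinders n) g) => //.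
- by move=> i; rewrite /g; case: unpickle => [p|]; [right; do 2!eexists|left].
- rewrite -subTset => z _.
  have [] : (\bigcup_(p : seq nat * nat) if `[< [set: nat] (nth 0%N p.1 0) >] then cyl_at n 0 (- (Num.bound `|(z 0%N).2|)%:R) p else set0) z.
    rewrite -(cover setT) //=; split => //.
    by rewrite ltrNl (le_lt_trans (ler_norm _))// normrN; exact: archi_boundP.
  move=> p _; rewrite asboolT// => zp.
  exists (pickle (p.1, maxn p.2 (Num.bound `|(z 0%N).2|))) => //.
  rewrite /g pickleK => k kn /=; have [-> b] := zp k kn; split => //.
  apply: le_lt_trans b.
  by case: ifP => _; rewrite lerN2 ler_nat ?leq_maxl ?leq_maxr.
- move=> _ [->|[y [t ->]]]; first by rewrite !measure0.
  (* Where durations are positive, a threshold may be replaced by its maximum with 0. *)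
  have clip d (O : measurableType d) (B : set O) Z : 
      (forall w k, B w -> (k <= n)%N -> 0 < (Z w k).2) ->
      B `&` Z @^-1` cylinder n y t = B `&` Z @^-1` cylinder n y (fun k => Num.max (t k) 0).
    move=> pos; apply/seteqP; split => w [Bw h]; split => //= k kn; have [zk tk] := h k kn.
      by rewrite gt_max tk pos.
    by move: tk; rewrite gt_max => /andP[].
  apply: (etrans (nu1E _)); apply: etrans (esym (nu2E _)).
  rewrite (clip _ _ _ _ pos1) (clip _ _ _ _ pos2); apply: m12 => k.
  by rewrite le_max lexx orbT.
- move=> i; apply: (@eq_ind_r _ _ (fun x => (x < +oo)%E) _ _ (nu1E _)).
  apply: le_lt_trans (fin_num_fun_lty (@fin_num_measure _ _ _ m1)).
  apply: le_measure; rewrite ?inE//; apply: measurableI => //.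
  rewrite -[X in measurable X]setTI; apply: (mZ1) => //.
  rewrite /g; case: unpickle => [p|]; last exact: measurable0.
  exact: measurable_cylinder.
Qed.

End Cylinders.

(** * Events that depend on finitely many jumps *)

Section Trajectories.
Context {R : realType}.
Local Notation traj := (nat -> nat * R).
Implicit Types (n k b : nat) (z : traj).

Definition shift z : traj := fun k => z k.+1.

(** Time 0 is left out, so that starting at b does not count as a return. *)
Definition avoid b n : set traj := [set z | forall k, (0 < k <= n)%N -> (z k).1 != b].

Lemma measurable_state_set n k (A : set nat) : (k <= n)%N ->
  measurable ([set z : traj | A (z k).1] : set (horizon n)).
Proof.
move=> kn; rewrite -[X in measurable X]setTI.
exact: (measurable_state kn measurableT (_ : measurable A)).
Qed.

Lemma measurable_states n (A : set nat) (J : set nat) : J `<=` [set k | (k <= n)%N] ->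
  measurable ([set z : traj | forall k, J k -> A (z k).1] : set (horizon n)).
Proof.
move=> Jn; rewrite [X in measurable X](_ : _ = \bigcap_(k in J) [set z : traj | A (z k).1]).
  by apply: bigcap_measurableType => k /Jn; exact: measurable_state_set.
by apply/seteqP; split.
Qed.

Lemma measurable_avoid b m n : (m <= n)%N -> measurable (avoid b m : set (horizon n)).
Proof.
move=> mn; rewrite [X in measurable X](_ : _ = [set z : traj |
    forall k, [set k | (0 < k <= m)%N] k -> [set j | j != b] (z k).1]).
  by apply: measurable_states => k /= /andP[_ km]; exact: leq_trans mn.
by apply/seteqP; split.
Qed.

Lemma measurable_duration_gt n k u : (k <= n)%N ->
  measurable ([set z : traj | u < (z k).2] : set (horizon n)).
Proof.
move=> kn; rewrite -[X in measurable X]setTI.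
rewrite [X in _ `&` X](_ : _ = (fun z : traj => (z k).2) @^-1` `]u, +oo[).
  exact: (measurable_duration kn).
by apply/seteqP; split => z /=; rewrite in_itv/= andbT.
Qed.

Lemma avoidS b n z : avoid b n.+1 z <-> (z 1%N).1 != b /\ avoid b n (shift z).
Proof.
split=> [h|[z1 h] [//|[|k]] //]; last by move=> kn; exact: h.
by split=> [|k /andP[k0 kn]]; apply: h.
Qed.

End Trajectories.

(** * One-step analysis of the chain *)

Section Chain.
Context {R : realType} {disp : measure_display} {Omega : measurableType disp}.
Variables (Q : nat -> nat -> R) (P : nat -> probability Omega R).
Variables (Y : nat -> Omega -> nat) (hold : nat -> Omega -> R).
Hypotheses (Q_sb : single_birth Q) (X_chain : markov_chain Q P Y hold).
Implicit Types (i j k n m b : nat) (t u : R) (w : Omega).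
Local Notation traj := (nat -> nat * R).
Local Notation q := (jump_rate Q).

Let q_gt0 := jump_rate_gt0 Q_sb.
Let p_ge0 := jump_prob_ge0 Q_sb.
Let mY := mc_measurable_jump X_chain.
Let mhold := mc_measurable_hold X_chain.
Let hold_gt0 := mc_hold_gt0 X_chain.

Definition run w : traj := fun k => (Y k w, hold k w).

Lemma measurable_run n : measurable_fun setT (run : Omega -> horizon n).
Proof. by apply: measurable_traj => k _; [exact: mY|exact: mhold]. Qed.

Lemma measurable_run_shift n : measurable_fun setT (shift \o run : Omega -> horizon n).
Proof. by apply: measurable_traj => k _; [exact: mY|exact: mhold]. Qed.

Lemma measurable_event n (D : set (horizon n)) : measurable D -> measurable (run @^-1` D).
Proof. by move=> mD; rewrite -[X in measurable X]setTI; exact: (@measurable_run n measurableT _ mD). Qed.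

Lemma measurable_event_shift n (D : set (horizon n)) :
  measurable D -> measurable ((shift \o run) @^-1` D).
Proof. by move=> mD; rewrite -[X in measurable X]setTI; exact: (@measurable_run_shift n measurableT _ mD). Qed.

Lemma measurable_at n j : measurable [set w | Y n w = j].
Proof. by rewrite -[X in measurable X]setTI; exact: (mY n measurableT (_ : measurable [set j])). Qed.

Lemma measurable_hold_gt n u : measurable [set w | u < hold n w].
Proof.
rewrite -[X in measurable X]setTI [X in _ `&` X](_ : _ = hold n @^-1` `]u, +oo[).
  exact: (mhold n).
by apply/seteqP; split => w /=; rewrite in_itv/= andbT.
Qed.

Definition weight i n (y : nat -> nat) (t : nat -> R) : R :=
  (y 0%N == i)%:R * (\prod_(k < n) jump_prob Q (y k) (y k.+1))
     * \prod_(k < n.+1) expR (- (q (y k) * t k)).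

Lemma law_cylinder i n (y : nat -> nat) (t : nat -> R) : (forall k, 0 <= t k) ->
  P i (run @^-1` cylinder n y t) = (weight i n y t)%:E.
Proof. exact: mc_law. Qed.

Lemma weight_ge0 i n (y : nat -> nat) (t : nat -> R) : 0 <= weight i n y t.
Proof.
rewrite /weight !mulr_ge0 ?ler0n//; apply: prodr_ge0 => // k _; exact: expR_ge0.
Qed.

Lemma prob_start i : P i [set w | Y 0 w = i] = 1%E.
Proof.
transitivity (P i (run @^-1` cylinder 0 (fun=> i) (fun=> 0))).
  congr (P i _); apply/seteqP; split => w /=.
    by move=> Yi [|//] _ /=; rewrite hold_gt0.
  by move=> /(_ 0%N (leqnn _))[].
by rewrite law_cylinder// /weight big_ord0 big_ord1 mulr0 oppr0 expR0 eqxx !mulr1.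
Qed.

Lemma prob_inter1 i (A S : set Omega) : measurable A -> measurable S ->
  P i S = 1%E -> P i (A `&` S) = P i A.
Proof.
move=> mA mS S1; have SC : P i (~` S) = 0%E by rewrite probability_setC// S1 subee.
rewrite -[in RHS](setIT A) -(setUv S) setIUr measureU//; first last.
- by rewrite setIACA setICr setI0.
- by apply: measurableI => //; exact: measurableC.
- exact: measurableI.
rewrite [X in (_ = _ + X)%E](_ : _ = 0%E) ?adde0//.
apply/eqP; rewrite eq_le measure_ge0 andbT -SC.
by apply: le_measure; rewrite ?inE//; [apply: measurableI => //|]; exact: measurableC.
Qed.

(** Prepending state i with threshold a to a cylinder multiplies its weight by the factor on the
    right; [law_unique] extends this from cylinders to D. *)
Lemma one_step i k a n (D : set (horizon n)) : 0 <= a -> measurable D ->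
  P i ([set w | a < hold 0 w /\ Y 1 w = k] `&` (shift \o run) @^-1` D) =
  ((expR (- (q i * a)) * jump_prob Q i k)%:E * P k (run @^-1` D))%E.
Proof.
move=> a0 mD.
have mB : measurable [set w | a < hold 0 w /\ Y 1 w = k].
  by apply: measurableI; [exact: measurable_hold_gt|exact: measurable_at].
have m0 := measurable_at 0 i.
rewrite -(prob_inter1 _ m0 (prob_start i)); last first.
  by apply: measurableI => //; exact: measurable_event_shift.
rewrite setIAC -(setTI (run @^-1` D)).
apply: (@law_unique _ _ _ _ _ (P i) (P k) n) => //.
- exact: measurableI.
- exact: measurable_run_shift.
- exact: measurable_run.
- by rewrite mulr_ge0 ?expR_ge0.
- by move=> w l _ _; exact: hold_gt0.
- by move=> w l _ _; exact: hold_gt0.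
move=> y t t0; rewrite setTI law_cylinder//.
have [yk|yk] := eqVneq (y 0%N) k; last first.
  rewrite /weight (negbTE yk) !mul0r mule0.
  rewrite [X in P i X](_ : _ = set0) ?measure0//.
  apply/seteqP; split => // w [[[_ /= Yk] _]] /(_ 0%N (leq0n _))[/= Yy _].
  by move: yk; rewrite -Yy Yk eqxx.
pose y' l := if l is l'.+1 then y l' else i.
pose t' l := if l is l'.+1 then t l' else a.
transitivity (P i (run @^-1` cylinder n.+1 y' t')).
  congr (P i _); apply/seteqP; split => w /=.
    by move=> [[[ah Yk] Y0] h] [|l] ln /=; [split|exact: h].
  move=> h; have [Y0 ah] := h 0%N isT; have [Y1 _] := h 1%N isT.
  by split; [split => //; split => //; rewrite -yk|move=> l ln; exact: h l.+1 ln].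
rewrite law_cylinder; last by case.
rewrite -EFinM; congr EFin.
rewrite /weight big_ord_recl [in LHS]big_ord_recl/= yk !eqxx !mul1r -!mulrA.
by rewrite mulrC -!mulrA mulrC -!mulrA; ring.
Qed.

Lemma prob_jump i k : P i [set w | Y 1 w = k] = (jump_prob Q i k)%:E.
Proof.
have := @one_step i k 0 0 setT (lexx _) measurableT.
rewrite preimage_setT setIT mulr0 oppr0 expR0 mul1r preimage_setT probability_setT mule1 => <-.
by congr (P i _); apply/seteqP; split => w /= => [|[]//]; rewrite hold_gt0.
Qed.

(** The first jump lands in 0, ..., i+1 almost surely, because the jump probabilities to these
    states already sum to 1. *)
Lemma prob_first_step i (A : set Omega) : measurable A ->
  P i A = (\sum_(k < i.+2) P i (A `&` [set w | Y 1 w = k]))%E.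
Proof.
move=> mA; pose U : set Omega := \big[setU/set0]_(k < i.+2) [set w | Y 1 w = k].
have tU (B : set Omega) : measurable B ->
    P i (B `&` U) = (\sum_(k < i.+2) P i (B `&` [set w | Y 1 w = k]))%E.
  move=> mB; rewrite /U big_distrr/= (@measure_bigsetU_ord _ _ _ (P i) _ _ (fun k : 'I_i.+2 => B `&` [set w | Y 1 w = k]))//.
    by move=> k; apply: measurableI => //; exact: measurable_at.
  apply/trivIsetP => k l _ _ kl; apply/seteqP; split => // w [[_ /= Yk] [_ /= Yl]].
  by move: kl; rewrite -val_eqE/= -Yk -Yl eqxx.
have mU : measurable U by apply: bigsetU_measurable => k _; exact: measurable_at.
rewrite -tU// prob_inter1//.
have := tU setT measurableT; rewrite setTI => ->.
under eq_bigr do rewrite setTI prob_jump.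
by rewrite sumEFin jump_prob_sum1.
Qed.

Lemma one_step_sum i a n (D : set (horizon n)) : 0 <= a -> measurable D ->
  P i ([set w | a < hold 0 w] `&` (shift \o run) @^-1` D) =
  (\sum_(k < i.+2) (expR (- (q i * a)) * jump_prob Q i k)%:E * P k (run @^-1` D))%E.
Proof.
move=> a0 mD; rewrite prob_first_step; last first.
  by apply: measurableI; [exact: measurable_hold_gt|exact: measurable_event_shift].
by apply: eq_bigr => k _; rewrite -one_step// setIAC.
Qed.

(** The link between the law and the killed kernel. The threshold u is kept so that integrating over
    u yields mean holding times, while u = 0 yields survival probabilities. *)
Lemma avoid_tail b n i u : 0 <= u ->
  P i (run @^-1` (avoid b n `&` [set z | u < (z n).2])) =
  (iter n (killed Q b) (fun k => expR (- (q k * u))) i)%:E.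
Proof.
move=> u0; elim: n i => [|n IH] i.
  transitivity (P i (run @^-1` cylinder 0 (fun=> i) (fun=> u))).
    transitivity (P i ([set w | u < hold 0 w] `&` [set w | Y 0 w = i])).
      rewrite prob_inter1 ?prob_start//; [|exact: measurable_hold_gt|exact: measurable_at].
      by congr (P i _); apply/seteqP; split => w /= => [[]//|uh]; split => // -[].
    congr (P i _); apply/seteqP; split => w /=; first by move=> [uh Yi] [|//] _.
    by move=> /(_ 0%N (leqnn _))[].
  by rewrite law_cylinder// /weight big_ord0 big_ord1 eqxx !mul1r.
have mD m : measurable (avoid b m `&` [set z : traj | u < (z m).2] : set (horizon m)).
  by apply: measurableI; [exact: measurable_avoid|exact: measurable_duration_gt].
rewrite prob_first_step; last exact: measurable_event (mD n.+1).
rewrite /= /killed (bigID (fun k : 'I_i.+2 => nat_of_ord k != b))/=.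
rewrite [X in (_ + X)%E]big1 ?adde0; last first.
  move=> k /negPn/eqP kb; rewrite [X in P i X](_ : _ = set0) ?measure0//.
  by apply/seteqP; split => // w [[/avoidS[/eqP + _] _] /= Yk]; rewrite /= Yk kb.
rewrite -sumEFin; apply: eq_bigr => k kb.
have := @one_step i k 0 n _ (lexx _) (mD n).
rewrite mulr0 oppr0 expR0 mul1r IH EFinM => <-; congr (P i _).
apply/seteqP; split => w /=.
  by move=> [[/avoidS[_ h] uh] Yk]; split; [rewrite hold_gt0|split].
by move=> [[_ Yk] [h uh]]; split => //; split => //; apply/avoidS; rewrite /= Yk.
Qed.

Lemma prob_avoid b n i : P i (run @^-1` avoid b n) = (survival Q b n i)%:E.
Proof.
rewrite -(_ : run @^-1` (avoid b n `&` [set z | 0 < (z n).2]) = run @^-1` avoid b n).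
  rewrite avoid_tail// /survival; congr (iter n _ _ i)%:E.
  by apply/funext => k; rewrite mulr0 oppr0 expR0.
by apply/seteqP; split => w /= => [[]//|h]; split => //=; rewrite hold_gt0.
Qed.

Lemma integral_expR_rate k :
  (\int[lebesgue_measure]_(u in `[0%R, +oo[) (expR (- (q k * u)))%:E = (mean_hold Q k)%:E)%E.
Proof.
have mE : measurable_fun (`[0%R, +oo[ : set R) (fun u : R => (expR (- (q k * u)))%:E).
  apply/measurable_EFinP; apply: measurable_funTS.
  by apply: measurableT_comp => //; apply: measurableT_comp => //; exact: measurable_funM.
have /eqP := @integral_exponential_pdf R (q k) (q_gt0 k).
have -> : (fun x => (exponential_pdf (q k) x)%:E) =
    ((fun x => (q k)%:E * (expR (- (q k * x)))%:E) \_ `[0%R, +oo[)%E.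
  apply/funext => x; rewrite /exponential_pdf !patchE; case: ifP => [_|_].
    by rewrite (mulNr (q k)) -EFinM.
  by [].
rewrite -integral_mkcond ge0_integralZl//; last by rewrite lee_fin ltW.
set I := (\int[_]_(_ in _) _)%E.
have I0 : (0 <= I)%E by apply: integral_ge0 => u _; rewrite lee_fin expR_ge0.
case: I I0 => [r| |] // _ /eqP.
  move=> -[] qr; congr EFin; rewrite /mean_hold.
  by apply: (@mulfI _ (q k)); rewrite ?gt_eqF// qr divff ?gt_eqF.
by rewrite gt0_muley ?lte_fin.
Qed.

Lemma measurable_iter_killed b n i :
  measurable_fun setT (fun u => iter n (killed Q b) (fun k => expR (- (q k * u))) i).
Proof.
elim: n i => [|n IH] i /=.
  by apply: measurableT_comp => //; apply: measurableT_comp => //; exact: measurable_funM.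
under eq_fun do rewrite killed_if.
apply: measurable_sum => k.
exact: measurable_funM.
Qed.

Lemma integral_iter_killed b n i :
  (\int[lebesgue_measure]_(u in `[0%R, +oo[)
     (iter n (killed Q b) (fun k => expR (- (q k * u))) i)%:E =
   (iter n (killed Q b) (mean_hold Q) i)%:E)%E.
Proof.
elim: n i => [|n IH] i /=; first exact: integral_expR_rate.
have pos m j u : 0 <= iter m (killed Q b) (fun k => expR (- (q k * u))) j.
  by apply: (iter_killed_ge0 Q_sb) => k; exact: expR_ge0.
have p0 (k : 'I_i.+2) : 0 <= if nat_of_ord k != b then jump_prob Q i k else 0 by case: ifP.
under eq_integral do rewrite killed_if -sumEFin.
rewrite ge0_integral_sum//; last 2 first.
- move=> k; apply/measurable_EFinP; apply: measurable_funTS; apply: measurable_funM => //.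
  exact: measurable_iter_killed.
- by move=> k u _; rewrite lee_fin mulr_ge0 ?p0 ?pos.
rewrite killed_if -sumEFin; apply: eq_bigr => k _; rewrite EFinM -IH -ge0_integralZl ?lee_fin ?p0//.
- by apply/measurable_EFinP; apply: measurable_funTS; exact: measurable_iter_killed.
- by move=> u _; rewrite lee_fin.
Qed.

(** Layer-cake formula: for u >= 0, the product exceeds u exactly on the event of [avoid_tail]. *)
Lemma integral_hold_avoid b n i :
  (\int[P i]_w ((hold n w)%:E * (\1_(run @^-1` avoid b n) w)%:E) =
   (iter n (killed Q b) (mean_hold Q) i)%:E)%E.
Proof.
have mE : measurable (run @^-1` avoid b n) by apply: measurable_event (measurable_avoid _ (leqnn n)).
pose X0 w := hold n w * \1_(run @^-1` avoid b n) w.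
have mX0 : measurable_fun setT X0 by apply: measurable_funM => //; exact: mhold.
pose X : {RV (P i) >-> R} := mfun_Sub (mem_set mX0).
have X0_ge0 w : 0 <= X w by rewrite /X/= /X0 mulr_ge0// ltW.
have := ge0_expectation_ccdf X0_ge0; rewrite expectation_def.
have -> : (\int[P i]_w (X w)%:E = \int[P i]_w ((hold n w)%:E * (\1_(run @^-1` avoid b n) w)%:E))%E.
  by apply: eq_integral => w _; rewrite -EFinM.
move=> ->; rewrite -integral_iter_killed; apply: eq_integral => u.
rewrite inE/= in_itv/= andbT => u0; rewrite -avoid_tail// /ccdf /distribution /pushforward/=.
congr (P i _); apply/seteqP; split => w /=; rewrite in_itv/= andbT /X0 indicE.
  case: (asboolP (avoid b n (run w))) => h; last first.
    by rewrite memNset// mulr0 ltNge u0.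
  by rewrite mem_set// mulr1.
by move=> [h uh]; rewrite mem_set// mulr1.
Qed.

End Chain.

(** * Return times and explosion *)

Lemma cvg_sum_ord (R : realType) (f : nat -> nat -> R) (l : nat -> R) n :
  (forall k, f k m @[m --> \oo] --> l k) ->
  \sum_(k < n) f k m @[m --> \oo] --> \sum_(k < n) l k.
Proof.
move=> fl; elim: n => [|n IH].
  by under eq_fun do rewrite big_ord0; rewrite big_ord0; exact: cvg_cst.
by under eq_fun do rewrite big_ord_recr; rewrite big_ord_recr; exact: cvgD.
Qed.

Section ReturnTime.
Context {R : realType} {disp : measure_display} {Omega : measurableType disp}.
Variables (Q : nat -> nat -> R) (P : nat -> probability Omega R).
Variables (Y : nat -> Omega -> nat) (hold : nat -> Omega -> R).
Hypotheses (Q_sb : single_birth Q) (X_chain : markov_chain Q P Y hold).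
Implicit Types (i j k n m b : nat) (t u : R) (w : Omega).
Local Notation traj := (nat -> nat * R).
Local Notation q := (jump_rate Q).
Local Notation J := (jump_time hold).
Local Notation run := (run Y hold).

Let q_gt0 := jump_rate_gt0 Q_sb.
Let p_ge0 := jump_prob_ge0 Q_sb.
Let mhold := mc_measurable_hold X_chain.
Let hold_gt0 := mc_hold_gt0 X_chain.

Lemma jump_timeS n w : J n.+1 w = J n w + hold n w.
Proof. exact: big_ord_recr. Qed.

Lemma jump_time0 w : J 0 w = 0.
Proof. exact: big_ord0. Qed.

Lemma jump_time_nd w : {homo J^~ w : m n / (m <= n)%N >-> m <= n}.
Proof.
by apply/nondecreasing_seqP => n; rewrite jump_timeS lerDl ltW.
Qed.

Lemma jump_time_ge0 n w : 0 <= J n w.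
Proof. by rewrite -(jump_time0 w); exact: jump_time_nd. Qed.

Lemma jump_time_lt_index m n w t : J m w <= t < J n w -> (m < n)%N.
Proof.
by move=> /andP[mt tn]; rewrite ltnNge; apply/negP => /(jump_time_nd w); lra.
Qed.

Lemma jump_interval_uniq m n w t : J m w <= t < J m.+1 w -> J n w <= t < J n.+1 w -> m = n.
Proof.
move=> /andP[m1 m2] /andP[n1 n2].
have mn : (m < n.+1)%N by apply: (@jump_time_lt_index _ _ w t); rewrite m1.
have nm : (n < m.+1)%N by apply: (@jump_time_lt_index _ _ w t); rewrite n1.
by apply/eqP; rewrite eqn_leq -ltnS mn -ltnS nm.
Qed.

Lemma X_SomeP t w j : X Y hold t w = Some j <-> exists n, J n w <= t < J n.+1 w /\ Y n w = j.
Proof.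
split=> [|[n [tn <-]]].
  rewrite /X; case: xgetP => [y -> [n /= nt <-] [<-]|//]; by exists n.
rewrite /X; apply: xget_subset1; first by exists n.
by move=> _ _ [k /= tk <-] [l /= tl <-]; rewrite (jump_interval_uniq tk tl).
Qed.

Lemma return_time_le n b w : (0 < n)%N -> Y n w = b ->
  (return_time Y hold b w <= (J n w)%:E)%E.
Proof.
move=> n0 Yn; apply: ereal_inf_lbound; exists (J n w) => //; split.
  exact: jump_time_nd.
by apply/X_SomeP; exists n; rewrite lexx jump_timeS ltrDl hold_gt0.
Qed.

Lemma return_time_first N b w : (0 < N)%N -> Y N w = b ->
  (forall k, (0 < k < N)%N -> Y k w != b) -> return_time Y hold b w = (J N w)%:E.
Proof.
move=> N0 YN first; apply/eqP; rewrite eq_le return_time_le//=.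
apply: le_ereal_inf_tmp => _ [t [J1t /X_SomeP[n [/andP[nt tn] Yn]]] <-].
rewrite lee_fin (le_trans _ nt)//; apply: jump_time_nd.
rewrite leqNgt; apply/negP => nN.
have n0 : (0 < n)%N.
  by rewrite lt0n; apply/eqP => n0; move: tn; rewrite n0; lra.
by have := first n; rewrite n0 nN Yn eqxx => /(_ isT).
Qed.

Lemma return_time_never b w : (forall k, (0 < k)%N -> Y k w != b) ->
  return_time Y hold b w = +oo%E.
Proof.
move=> nb; rewrite /return_time; rewrite [X in ereal_inf X](_ : _ = set0) ?ereal_inf0//.
apply/seteqP; split => // _ [t [J1t /X_SomeP[n [/andP[nt tn] Yn]]] <-].
have n0 : (0 < n)%N.
  by rewrite lt0n; apply/eqP => n0; move: tn; rewrite n0; lra.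
by have := nb n n0; rewrite Yn eqxx.
Qed.

Definition never b : set traj := \bigcap_n avoid b n.

Lemma neverP b w : never b (run w) <-> forall k, (0 < k)%N -> Y k w != b.
Proof.
split=> [h k k0|h n _ k /andP[k0 _]]; last exact: h.
by have := h k I k; rewrite k0 leqnn; exact.
Qed.

Lemma first_return b w : ~ never b (run w) -> exists N,
  [/\ (0 < N)%N, Y N w = b & forall k, (0 < k < N)%N -> Y k w != b].
Proof.
move=> nn; have ex : exists N, (0 < N)%N && (Y N w == b).
  apply: contrapT => h; apply: nn; apply/neverP => k k0; apply/negP => Yk.
  by apply: h; exists k; rewrite k0.
case: (ex_minnP ex) => N /andP[N0 /eqP YN] min; exists N; split => // k /andP[k0 kN].
by apply/negP => Yk; have := min k; rewrite k0 Yk => /(_ isT); rewrite leqNgt kN.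
Qed.

Lemma measurable_never b : measurable (run @^-1` never b).
Proof.
rewrite /never preimage_bigcap; apply: bigcapT_measurable => n.
exact: (measurable_event X_chain (measurable_avoid b (leqnn n))).
Qed.

(* On the event that b is never revisited the second series is infinite. *)
Lemma return_time_series b w : return_time Y hold b w =
  (\sum_(0 <= k <oo) ((hold k w)%:E * (\1_(run @^-1` avoid b k) w)%:E
                      + (\1_(run @^-1` never b) w)%:E))%E.
Proof.
have t0 k : (0 <= (hold k w)%:E * (\1_(run @^-1` avoid b k) w)%:E
                      + (\1_(run @^-1` never b) w)%:E)%E.
  by rewrite adde_ge0 ?mule_ge0 ?lee_fin// ltW.
have [nev|/[dup] nev /first_return[N [N0 YN first]]] := pselect (never b (run w)).
  rewrite return_time_never; last exact/neverP.
  apply/esym/eqyP => A A0; have := archi_boundP (ltW A0).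
  set n := Num.bound A => An.
  apply: le_trans (nneseries_lim_ge n (fun k _ _ => t0 k)).
  apply: (@le_trans _ _ (\sum_(0 <= k < n) (1 : \bar R))%E).
    by rewrite big_mkord sumEFin lee_fin sumr_const card_ord ltW.
  have -> : \1_(run @^-1` never b) w = 1 :> R by rewrite indicE mem_set.
  apply: lee_sum => k _; rewrite leeDr//.
  by rewrite mule_ge0 ?lee_fin// ltW.
rewrite (return_time_first N0 YN first).
apply/esym/lim_near_cst => //; exists N => // n /= Nn.
rewrite (@big_cat_nat _ _ _ N)//= [X in (_ + X)%E]big1_seq ?adde0.
  rewrite big_mkord /jump_time -sumEFin; apply: eq_bigr => k _.
  rewrite !indicE mem_set ?memNset ?mule1 ?adde0//= => l /andP[l0 lk].
  by apply: first; rewrite l0 (leq_ltn_trans lk).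
move=> k /andP[_]; rewrite mem_index_iota => /andP[Nk _].
rewrite !indicE !memNset ?mule0 ?adde0// => /(_ N); rewrite N0 Nk => /(_ isT).
by rewrite /= YN eqxx.
Qed.

Lemma return_time_ge0 b w : (0 <= return_time Y hold b w)%E.
Proof.
apply: le_ereal_inf_tmp => _ [t [J1t _] <-].
by rewrite lee_fin (le_trans (jump_time_ge0 1 w)).
Qed.

Let measurable_hold_avoid b k :
  measurable_fun setT (fun w => ((hold k w)%:E * (\1_(run @^-1` avoid b k) w)%:E)%E).
Proof.
apply: emeasurable_funM; apply/measurable_EFinP; first exact: mhold.
exact: measurable_indic (measurable_event X_chain (measurable_avoid b (leqnn k))).
Qed.

Let hold_avoid_ge0 b k w : (0 <= (hold k w)%:E * (\1_(run @^-1` avoid b k) w)%:E)%E.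
Proof. by rewrite mule_ge0 ?lee_fin// ltW. Qed.

Lemma measurable_return_time b : measurable_fun setT (return_time Y hold b).
Proof.
rewrite (funext (return_time_series b)).
apply: ge0_emeasurable_sum => k *.
- by apply: adde_ge0; [exact: hold_avoid_ge0|rewrite lee_fin].
- apply: emeasurable_funD => //; apply/measurable_EFinP.
  exact: measurable_indic (measurable_never b).
Qed.

(** The series for the return time is integrated term by term; the null hypothesis removes the
    indicator of [never b]. *)
Lemma mean_returnE i b : P i (run @^-1` never b) = 0%E ->
  mean_return P Y hold i b = mean_time Q b i.
Proof.
move=> nev; have mnev := measurable_never b.
have mI : measurable_fun setT (fun w => (\1_(run @^-1` never b) w)%:E : \bar R).
  by apply/measurable_EFinP; exact: measurable_indic.
rewrite /mean_return (funext (return_time_series b)).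
rewrite integral_nneseries//; first last.
- by move=> k w _; apply: adde_ge0; [exact: hold_avoid_ge0|rewrite lee_fin].
- by move=> k; exact: emeasurable_funD.
apply: eq_eseriesr => k _.
rewrite ge0_integralD//.
rewrite (integral_hold_avoid Q_sb X_chain).
rewrite (_ : \int[P i]_w (\1_(run @^-1` never b) w)%:E = 0)%E ?adde0//.
by rewrite integral_indic// setIT; exact: nev.
Qed.

Lemma never_cvg i b : survival Q b m i @[m --> \oo] --> fine (P i (run @^-1` never b)).
Proof.
have mav m := measurable_event X_chain (measurable_avoid b (leqnn m)).
have : (P i \o (fun m => run @^-1` avoid b m)) m @[m --> \oo] --> P i (\bigcap_m run @^-1` avoid b m).
  apply: nonincreasing_cvg_mu => //.
  - by rewrite (le_lt_trans (probability_le1 _ _))// ltry.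
  - exact: bigcapT_measurable.
  - move=> m n mn; apply/subsetPset => w h k /andP[k0 km]; apply: h.
    by rewrite k0 (leq_trans km).
rewrite -preimage_bigcap -/(never b) -[P i (run @^-1` never b)]fineK; last first.
  by rewrite fin_num_measure//; exact: measurable_never.
move=> /fine_cvg; apply: cvg_trans.
apply: near_eq_cvg; apply: nearW => m /=.
by rewrite (prob_avoid Q_sb X_chain).
Qed.

Lemma never_null_iff i b :
  P i (run @^-1` never b) = 0%E <-> survival Q b m i @[m --> \oo] --> 0.
Proof.
split=> [n0|s0]; first by rewrite -[0]/(fine 0%E) -n0; exact: never_cvg.
rewrite -[LHS]fineK ?fin_num_measure//; last exact: measurable_never.
by congr EFin; apply: (cvg_unique _ (@never_cvg i b) s0).
Qed.

Lemma recurrent_certain_hit : recurrent P Y hold ->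
  (forall b, P b (run @^-1` never b) = 0%E) /\ certain_hit Q.
Proof.
move=> rec; have n0 b : P b (run @^-1` never b) = 0%E.
  have mn := measurable_never b.
  have : P b (~` (run @^-1` never b)) = 1%E.
    rewrite -(rec b); congr (P b _); apply/seteqP; split => w /=.
      move=> /first_return[N [N0 YN first]].
      by rewrite (return_time_first N0 YN first) ltry.
    by move=> + nev; rewrite return_time_never ?ltxx//; exact/neverP.
  rewrite probability_setC// => h.
  rewrite -[LHS]fineK ?fin_num_measure//; congr EFin.
  by move: h; rewrite -[P b _]fineK ?fin_num_measure// -EFinB => -[]; lra.
by split => //; apply: (certain_hit_from0 Q_sb); exact/never_null_iff.
Qed.

(** Explosion no later than u. *)
Definition bounded_jumps u : set Omega := [set w | forall m, J m w <= u].

Lemma measurable_jump_time_le n m u : (m <= n.+1)%N ->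
  measurable ([set z : traj | \sum_(k < m) (z k).2 <= u] : set (horizon n)).
Proof.
move=> mn; rewrite -[X in measurable X]setTI.
rewrite [X in _ `&` X](_ : _ = (fun z : traj => \sum_(k < m) (z k).2) @^-1` `]-oo, u]).
  apply: (@measurable_sum _ (horizon n) R setT _ _ (fun (k : 'I_m) z => (z k).2)) => // k.
  by apply: measurable_duration; rewrite -ltnS (leq_trans _ mn).
by apply/seteqP; split => z /=; rewrite in_itv/=.
Qed.

Lemma measurable_J_le m u : measurable [set w | J m w <= u].
Proof. exact: (measurable_event X_chain (@measurable_jump_time_le m m u (leqnSn _))). Qed.

Lemma bounded_jumpsE u : bounded_jumps u = \bigcap_m [set w | J m w <= u].
Proof. by apply/seteqP; split => w // h m => [_|]; exact: h. Qed.

Lemma measurable_bounded_jumps u : measurable (bounded_jumps u).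
Proof. by rewrite bounded_jumpsE; apply: bigcapT_measurable => m; exact: measurable_J_le. Qed.

Lemma diverging_jumpsE : [set w | J n w @[n --> \oo] --> +oo] =
  ~` \bigcup_(k : nat) bounded_jumps k%:R.
Proof.
apply/seteqP; split => w /=.
  move=> /cvgryPgt Jy [k _ bk]; have [N _ NJ] := Jy k%:R.
  by have := NJ N (leqnn N); rewrite /= ltNge bk.
move=> nb; apply/cvgryPge => A; apply: contrapT => nA; apply: nb.
exists (Num.bound `|A|) => // m.
rewrite leNgt; apply/negP => Am; apply: nA; exists m => // n /= mn.
apply: (le_trans _ (jump_time_nd w mn)); apply/ltW/(lt_trans _ Am).
by rewrite (le_lt_trans (ler_norm _))// archi_boundP.
Qed.

Lemma measurable_diverging_jumps : measurable [set w | J n w @[n --> \oo] --> +oo].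
Proof.
rewrite diverging_jumpsE; apply: measurableC; apply: bigcupT_measurable => k.
exact: measurable_bounded_jumps.
Qed.

(** On a trajectory that neither explodes nor visits b again, the holding times counted by [g] sum
    to infinity, whereas the integral of [g] is at most [mean_time Q b i]. *)
Lemma never_null_of_mean_time i b : non_explosive P hold ->
  (mean_time Q b i < +oo)%E -> P i (run @^-1` never b) = 0%E.
Proof.
move=> ne mt; have mnev := measurable_never b; have mD := measurable_diverging_jumps.
rewrite -(prob_inter1 mnev mD (ne i)).
pose g w := (\sum_(0 <= k <oo) ((hold k w)%:E * (\1_(run @^-1` avoid b k) w)%:E))%E.
have mg : measurable_fun setT g.
  by apply: ge0_emeasurable_sum => k *.
have gi : (P i).-integrable setT g.
  apply/integrableP; split => //.
  rewrite (eq_integral g); last first.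
    by move=> w _; rewrite gee0_abs// nneseries_ge0.
  rewrite integral_nneseries//; apply: le_lt_trans mt; apply: lee_nneseries => k _.
    by rewrite integral_ge0.
  by rewrite (integral_hold_avoid Q_sb X_chain).
have /negligibleS := integrable_ae measurableT gi.
have mI := measurableI _ _ mnev mD.
move=> /(_ (run @^-1` never b `&` [set w | J n w @[n --> \oo] --> +oo])) h.
apply/(negligibleP _ mI)/h => w [/neverP nev /cvgryPge Jy] /(_ I).
rewrite ge0_fin_numE ?nneseries_ge0//; apply/negP; rewrite -leNgt leye_eq.
apply/eqP/eqyP => A A0; have [N _ NA] := Jy A.
apply: le_trans (nneseries_lim_ge N (fun k _ _ => hold_avoid_ge0 b k w)).
apply: (@le_trans _ _ (J N w)%:E); first by rewrite lee_fin; exact: NA N (leqnn N).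
rewrite big_mkord /jump_time -sumEFin; apply: lee_sum => k _.
by rewrite indicE mem_set ?mule1// => l /andP[l0 _]; exact: nev.
Qed.

Definition bounded_prob u i : R := fine (P i (bounded_jumps u)).

Lemma bounded_prob_ge0 u i : 0 <= bounded_prob u i.
Proof. by apply: fine_ge0; exact: measure_ge0. Qed.

Lemma bounded_prob_le1 u i : bounded_prob u i <= 1.
Proof.
have mb := measurable_bounded_jumps u.
by rewrite -lee_fin fineK ?fin_num_measure//; exact: probability_le1.
Qed.

Lemma bounded_prob_cvg u i :
  fine (P i [set w | J m w <= u]) @[m --> \oo] --> bounded_prob u i.
Proof.
apply: fine_cvg; rewrite /bounded_prob fineK; last first.
  by rewrite fin_num_measure//; exact: measurable_bounded_jumps.
rewrite bounded_jumpsE; apply: nonincreasing_cvg_mu => //.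
- by rewrite (le_lt_trans (probability_le1 _ _))// ?ltry//; exact: measurable_J_le.
- by move=> m; exact: measurable_J_le.
- by apply: bigcapT_measurable => m; exact: measurable_J_le.
- by move=> m n mn; apply/subsetPset => w; apply: le_trans; exact: jump_time_nd.
Qed.

(* If all the jumps occur before time u then so do those of the chain shifted
   by one step, and the first holding time is at most u. *)
Lemma bounded_prob_step u a i : 0 <= a -> u <= a ->
  bounded_prob u i <= (1 - expR (- (q i * a))) *
    \sum_(k < i.+2) jump_prob Q i k * bounded_prob u k.
Proof.
move=> a0 ua.
(* [one_step_sum] applies to events of finite horizon, so only the first m jump times are
   constrained at first; m tends to infinity at the end. *)
pose e m k := fine (P k [set w | J m w <= u]).
have eE m k : P k (run @^-1` [set z : traj | \sum_(l < m) (z l).2 <= u]) = (e m k)%:E.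
  by rewrite /e fineK// fin_num_measure//; exact: measurable_J_le.
have He m : bounded_prob u i <= (1 - expR (- (q i * a))) *
    \sum_(k < i.+2) jump_prob Q i k * e m k.
  have mD := @measurable_jump_time_le m m u (leqnSn m).
  have mS : measurable ((shift \o run) @^-1` [set z : traj | \sum_(l < m) (z l).2 <= u]).
    exact: (measurable_event_shift X_chain mD).
  have mh := measurable_hold_gt X_chain 0 a.
  rewrite -lee_fin fineK; last by rewrite fin_num_measure//; exact: measurable_bounded_jumps.
  apply: (@le_trans _ _ (P i ((shift \o run) @^-1` [set z : traj | \sum_(l < m) (z l).2 <= u]
      `\` [set w | a < hold 0 w]))).
    apply: le_measure; rewrite ?inE; [exact: measurable_bounded_jumps|exact: measurableD|].
    move=> w bw; split => /=.
      have := bw m.+1; rewrite /jump_time big_ord_recl/=.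
      by apply: le_trans; rewrite lerDr ltW.
    by apply/negP; rewrite -leNgt (le_trans _ ua)//; have := bw 1%N; rewrite /jump_time big_ord1.
  have PD S H : measurable S -> measurable H ->
      (P i (S `\` H) = P i S - P i (H `&` S))%E.
    move=> mS' mH; rewrite setIC; apply: measureD => //.
    by rewrite (le_lt_trans (probability_le1 _ _))// ltry.
  rewrite PD// (one_step_sum Q_sb X_chain i a0 mD).
  have -> : P i ((shift \o run) @^-1` [set z : traj | \sum_(l < m) (z l).2 <= u]) =
      (\sum_(k < i.+2) (jump_prob Q i k * e m k)%:E)%E.
    have := one_step_sum Q_sb X_chain i (lexx 0) mD.
    rewrite (_ : [set w | 0 < hold 0 w] = setT) ?setTI; last first.
      by apply/seteqP; split => w //= _.
    by move=> ->; apply: eq_bigr => k _; rewrite mulr0 oppr0 expR0 mul1r eE.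
  under [X in (_ - X)%E]eq_bigr do rewrite eE -EFinM -mulrA.
  rewrite !sumEFin -EFinB lee_fin -mulr_sumr.
  by rewrite mulrBl mul1r.
apply: (@ler_cvg_to _ \oo _ _ (fun=> bounded_prob u i)
  (fun m => (1 - expR (- (q i * a))) * \sum_(k < i.+2) jump_prob Q i k * e m k)).
- exact: cvg_cst.
- apply: cvgMr; apply: (@cvg_sum_ord _ (fun k m => jump_prob Q i k * e m k)
    (fun k => jump_prob Q i k * bounded_prob u k)) => k.
  by apply: cvgMr; exact: bounded_prob_cvg.
- exact: nearW.
Qed.

(* The explosion probability exceeds its value at 0 by a function that is
   subharmonic off 0, bounded and vanishing at 0, hence nonpositive; so its
   maximum is at 0, where [bounded_prob_step] is a strict contraction. *)
Lemma bounded_prob0 u i : certain_hit Q -> bounded_prob u i = 0.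
Proof.
(* u may be negative, while [bounded_prob_step] asks for a nonnegative bound of u. *)
move=> hit; pose a := `|u|; pose x := bounded_prob u.
have xstep j : x j <= (1 - expR (- (q j * a))) * \sum_(k < j.+2) jump_prob Q j k * x k.
  by apply: bounded_prob_step; rewrite /a ?ler_norm.
have s0 j : 0 <= \sum_(k < j.+2) jump_prob Q j k * x k.
  by apply: sumr_ge0 => k _; rewrite mulr_ge0 ?bounded_prob_ge0.
pose y j := x j - x 0%N.
have yA j : y j <= killed Q 0 y j.
  have y0 : y 0%N = 0 by rewrite /y subrr.
  have -> : killed Q 0 y j = \sum_(k < j.+2) jump_prob Q j k * y k.
    by rewrite (sum_jump_prob Q_sb) (killedE Q_sb) y0 mulr0 subr0.
  rewrite /y; under [leRHS]eq_bigr do rewrite mulrBr.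
  rewrite sumrB -mulr_suml (jump_prob_sum1 Q_sb) mul1r lerD2r.
  by apply: le_trans (xstep j) _; rewrite ler_piMl// gerBl expR_ge0.
have yle j : (0 < j)%N -> y j <= 0.
  move=> j0; apply: (@ler_cvg_to _ \oo _ _ (fun=> y j) (fun m => survival Q 0 m j)).
  - exact: cvg_cst.
  - exact: hit.
  apply: nearW => m; apply: (@le_trans _ _ (iter m (killed Q 0) y j)).
    elim: m => // m; move/le_trans; apply.
    rewrite iter_killedS; apply: (le_iter_killed Q_sb); first by rewrite -lt0n.
    by move=> k _; exact: yA.
  apply: (le_iter_killed Q_sb); first by rewrite -lt0n.
  move=> k _; rewrite /y; have := bounded_prob_le1 u k; have := bounded_prob_ge0 u 0.
  by rewrite /x; lra.
have x0 : x 0%N = 0.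
  apply/eqP; rewrite eq_le bounded_prob_ge0 andbT.
  have := xstep 0%N; set c := expR _.
  have c0 : 0 < c by exact: expR_gt0.
  have c1 : c <= 1 by rewrite -[leRHS]expR0 ler_expR oppr_le0 mulr_ge0 ?normr_ge0// ltW.
  (* State 0 jumps only to 1, where the explosion probability is at most its value at 0. *)
  have S : \sum_(k < 2) jump_prob Q 0 k * x k <= x 0%N.
    have := jump_prob_sum1 Q_sb 0; rewrite !big_ord_recr !big_ord0/= !add0r => p1.
    have := yle 1%N isT; rewrite /y => y1.
    apply: (@le_trans _ _ ((jump_prob Q 0 0 + jump_prob Q 0 1) * x 0%N)).
      by rewrite mulrDl lerD2l ler_wpM2l//; lra.
    by rewrite {1}/jump_prob eqxx add0r p1 mul1r.
  have c1' : 0 <= 1 - c by lra.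
  move=> /le_trans /(_ (ler_wpM2l c1' S)) h.
  have : c * x 0%N <= 0 by lra.
  by rewrite pmulr_rle0.
case: i => [|i]; first exact: x0.
apply/eqP; rewrite eq_le bounded_prob_ge0 andbT.
by have := yle i.+1 isT; rewrite /y x0 subr0.
Qed.

Lemma certain_hit_non_explosive : certain_hit Q -> non_explosive P hold.
Proof.
move=> hit i; rewrite diverging_jumpsE probability_setC; last first.
  by apply: bigcupT_measurable => k; exact: measurable_bounded_jumps.
rewrite (_ : P i _ = 0%E) ?sube0//; apply/eqP; rewrite eq_le measure_ge0 andbT.
have mb k := measurable_bounded_jumps k%:R.
apply: le_trans (le_mu_bigcup _ mb (bigcupT_measurable _ mb)) _.
rewrite eseries0// => k _ _.
by rewrite -[LHS]fineK ?fin_num_measure// -/(bounded_prob _ _) bounded_prob0.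
Qed.

End ReturnTime.

(** * The Markov property *)

Lemma measure_bigcupT (R : realType) d (T : measurableType d)
  (mu : {measure set T -> \bar R}) (F : (set T)^nat) :
  (forall n, measurable (F n)) -> trivIset setT F ->
  mu (\bigcup_n F n) = (\sum_(0 <= n <oo) mu (F n))%E.
Proof.
move=> mF tF; rewrite measure_bigcup//.
by apply: eq_eseriesl => n; rewrite in_setT.
Qed.

Lemma nneseriesZl_fin (R : realType) (x : \bar R) (f : (\bar R)^nat) :
  x \is a fin_num -> (forall n, 0 <= f n)%E ->
  (\sum_(0 <= n <oo) x * f n = x * \sum_(0 <= n <oo) f n)%E.
Proof. by move=> /fineK <- f0; exact: nneseriesZl. Qed.

Section MarkovProperty.
Context {R : realType} {disp : measure_display} {Omega : measurableType disp}.
Variables (Q : nat -> nat -> R) (P : nat -> probability Omega R).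
Variables (Y : nat -> Omega -> nat) (hold : nat -> Omega -> R).
Hypotheses (Q_sb : single_birth Q) (X_chain : markov_chain Q P Y hold).
Implicit Types (i j k l n m N : nat) (s t u : R) (w : Omega) (H A : set nat).
Local Notation traj := (nat -> nat * R).
Local Notation q := (jump_rate Q).
Local Notation J := (jump_time hold).
Local Notation run := (run Y hold).

Let q_gt0 := jump_rate_gt0 Q_sb.
Let mY := mc_measurable_jump X_chain.
Let mhold := mc_measurable_hold X_chain.
Let hold_gt0 := mc_hold_gt0 X_chain.

(** The two cylinders overlap at index n, where their thresholds add up. This is the memoryless
    property of the exponential law at the level of weights. *)
Lemma weight_cat i n N (y y' : nat -> nat) (t t' : nat -> R) : y' 0%N = y n ->
  weight Q i (n + N) (fun k => if (k <= n)%N then y k else y' (k - n)%N)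
    (fun k => if (k < n)%N then t k else
              if k == n then t n + t' 0%N else t' (k - n)%N) =
  weight Q i n y t * weight Q (y n) N y' t'.
Proof.
move=> y0; rewrite /weight leq0n y0 eqxx mul1r.
rewrite big_split_ord -addnS [X in _ * X = _]big_split_ord/=.
have -> : \prod_(k < n) jump_prob Q (if (k <= n)%N then y k else y' (k - n)%N)
    (if (k < n)%N then y k.+1 else y' (k.+1 - n)%N) = \prod_(k < n) jump_prob Q (y k) (y k.+1).
  by apply: eq_bigr => k _; rewrite ltn_ord ltnW.
have -> : \prod_(k < N) jump_prob Q (if (n + k <= n)%N then y (n + k)%N else y' (n + k - n)%N)
    (if (n + k < n)%N then y (n + k).+1 else y' ((n + k).+1 - n)%N) = \prod_(k < N) jump_prob Q (y' k) (y' k.+1).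
  apply: eq_bigr => k _; rewrite ltnNge leq_addr/= -addnS !addKn.
  case: ifP => //; rewrite -[leqRHS]addn0 leq_add2l leqn0 => /eqP ->.
  by rewrite addn0 y0.
have -> : \prod_(k < n) expR (- (q (if (k <= n)%N then y k else y' (k - n)%N) *
    (if (k < n)%N then t k else if nat_of_ord k == n then t n + t' 0%N else t' (k - n)%N))) =
    \prod_(k < n) expR (- (q (y k) * t k)).
  by apply: eq_bigr => k _; rewrite ltn_ord ltnW.
rewrite [X in _ * (_ * X) = _]big_ord_recl/= addn0 leqnn ltnn eqxx mulrDr opprD expRD.
rewrite [in RHS]big_ord_recr/= [X in _ = _ * (_ * X)]big_ord_recl/= y0.
have -> : \prod_(k < N) expR (- (q (if (n + bump 0 k <= n)%N then y (n + bump 0 k)%N else y' (n + bump 0 k - n)%N) *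
    (if (n + bump 0 k < n)%N then t (n + bump 0 k)%N else if (n + bump 0 k == n)%N then t n + t' 0%N else t' (n + bump 0 k - n)%N))) =
    \prod_(k < N) expR (- (q (y' (bump 0 k)) * t' (bump 0 k))).
  apply: eq_bigr => k _; rewrite /bump leq0n add1n addKn.
  rewrite leqNgt -[X in (X < _)%N]addn0 ltn_add2l/=.
  by rewrite ltnNge leq_addr/= -[X in _ == X]addn0 eqn_add2l.
ring.
Qed.

Definition shortened n u w : traj :=
  fun l => (Y l w, if l == n then hold l w - u else hold l w).

Lemma measurable_shortened n u N :
  measurable_fun setT (shortened n u : Omega -> horizon N).
Proof.
apply: measurable_traj => k _; first exact: mY.
rewrite /shortened /=; case: eqP => _; last exact: mhold.
by apply: measurable_funB => //; exact: mhold.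
Qed.

Definition future n N (y : nat -> nat) (t : nat -> R) : set Omega :=
  [set w | forall m, (m <= N)%N -> Y (n + m) w = y m /\ t m < hold (n + m) w].

Lemma measurable_future n N y (t : nat -> R) : measurable (future n N y t).
Proof.
rewrite (_ : future n N y t = \bigcap_(m in [set m | (m <= N)%N])
  ([set w | Y (n + m) w = y m] `&` [set w | t m < hold (n + m) w])); last first.
  by apply/seteqP; split => w.
apply: bigcap_measurableType => m _; apply: measurableI.
  exact: measurable_at X_chain _ _.
exact: measurable_hold_gt X_chain _ _.
Qed.

(** The past event D is read after removing [t 0] from the n-th holding time, which past and future
    share. With this overlap removed they are independent given Y n. *)
Lemma memoryless i n N (y : nat -> nat) (t : nat -> R) (D : set (horizon n)) :
  (forall k, 0 <= t k) -> measurable D ->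
  P i (future n N y t `&` shortened n (t 0%N) @^-1` D) =
  ((weight Q (y 0%N) N y t)%:E * P i ([set w | Y n w = y 0%N] `&` run @^-1` D))%E.
Proof.
move=> t0 mD; apply: (@law_unique _ _ _ _ _ (P i) (P i) n) => //.
- exact: measurable_future.
- exact: measurable_at X_chain _ _.
- exact: measurable_shortened.
- exact: measurable_run X_chain _.
- exact: (weight_ge0 Q_sb).
- move=> w k fw kn; rewrite /shortened /=; case: eqP => [->|_]; last exact: hold_gt0.
  by have [_] := fw 0%N isT; rewrite addn0 subr_gt0.
- by move=> w k _ _; exact: hold_gt0.
move=> y1 t1 t10.
have [yn|yn] := eqVneq (y 0%N) (y1 n); last first.
  rewrite [X in _ = (_ * P i X)%E](_ : _ = set0); last first.
    apply/seteqP; split => // w [/= Yn /(_ n (leqnn n))[/= Yn' _]].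
    by move: yn; rewrite -Yn -Yn' eqxx.
  rewrite measure0 mule0 [X in P i X](_ : _ = set0) ?measure0//.
  apply/seteqP; split => // w [/(_ 0%N isT)[+ _] /(_ n (leqnn n))[/= Yn' _]].
  by rewrite addn0 Yn' => /esym/eqP; rewrite (negbTE yn).
rewrite [X in _ = (_ * P i X)%E](_ : _ = run @^-1` cylinder n y1 t1); last first.
  apply/seteqP; split => w /=; first by case.
  by move=> c; split => //; have [/= -> _] := c n (leqnn n).
rewrite (law_cylinder X_chain)// -EFinM mulrC {1}yn -weight_cat//.
rewrite -(law_cylinder X_chain); last first.
  by move=> k; case: ifP => // _; case: ifP => // _; rewrite addr_ge0.
congr (P i _); apply/seteqP; split => w /=.
  move=> [fw cw] k kN /=.
  case: (ltngtP k n) => [kn|nk|->].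
  - by have [] := cw k (ltnW kn); rewrite /= (ltn_eqF kn).
  - by have := fw (k - n)%N; rewrite subnKC ?(ltnW nk)//; apply; rewrite leq_subLR.
  - have [/= -> +] := cw n (leqnn n); rewrite /= eqxx; split => //.
    by rewrite -ltrBrDr.
move=> cw; split => [m mN|k kn] /=.
  have := cw (n + m)%N; rewrite leq_add2l => /(_ mN)/=.
  case: (ltngtP (n + m) n) => [|nm|nm]; first by rewrite ltnNge leq_addr.
    by rewrite addKn.
  have -> : m = 0%N by lia.
  by rewrite addn0 -yn => -[-> h]; split => //; apply: le_lt_trans h; rewrite lerDr.
have := cw k (leq_trans kn (leq_addr _ _)); rewrite /=.
rewrite kn; have [kn'|nk] := ltnP k n; first by rewrite (ltn_eqF kn').
have -> : k = n by apply/eqP; rewrite eqn_leq kn.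
by rewrite eqxx => -[-> ?]; split => //; rewrite ltrBrDr.
Qed.

Definition jt (z : traj) n : R := \sum_(k < n) (z k).2.

(* The chain observed from time s on, when it has made n jumps by time s. *)
Definition after n s w : traj :=
  fun m => (Y (n + m) w, if m == 0%N then J n.+1 w - s else hold (n + m) w).

(** H is the set of states allowed so far: [setT] gives transition probabilities, the nonzero states
    give those with 0 as a taboo. *)
Definition at_jump H A t n : set traj :=
  [set z | [/\ forall l, (l <= n)%N -> H (z l).1, A (z n).1 & jt z n <= t < jt z n.+1]].

Definition alive H A t : set traj := \bigcup_n at_jump H A t n.

Lemma measurable_jt n m : (m <= n.+1)%N ->
  measurable_fun setT ((jt^~ m) : horizon n -> R).
Proof.
move=> mn; apply: (@measurable_sum _ (horizon n) R setT _ _ (fun (k : 'I_m) z => (z k).2)) => // k.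
by apply: measurable_duration; rewrite -ltnS (leq_trans _ mn).
Qed.

Lemma measurable_at_jump H A t n : measurable (at_jump H A t n : set (horizon n)).
Proof.
rewrite (_ : at_jump H A t n = ([set z : traj | forall k, [set k | (k <= n)%N] k -> H (z k).1] `&`
   [set z | A (z n).1]) `&` (jt^~ n @^-1` `]-oo, t] `&` jt^~ n.+1 @^-1` `]t, +oo[)).
  apply: measurableI; first apply: measurableI.
  - exact: measurable_states.
  - exact: measurable_state_set.
  - apply: measurableI; rewrite -[X in measurable X]setTI.
      by apply: (@measurable_jt n n (leqnSn n)).
    by apply: (@measurable_jt n n.+1 (leqnn _)).
apply/seteqP; split => z /=; rewrite !in_itv/= andbT.
  by move=> [h a /andP[-> ->]].
by move=> [[h a] [tn nt]]; split => //; rewrite tn.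
Qed.

Lemma measurable_at_jump_run H A t n : measurable (run @^-1` at_jump H A t n).
Proof. exact: (measurable_event X_chain (@measurable_at_jump H A t n)). Qed.

Lemma measurable_alive H A t : measurable (run @^-1` alive H A t).
Proof.
rewrite preimage_bigcup; apply: bigcupT_measurable => n; exact: measurable_at_jump_run.
Qed.

Lemma at_jump_uniq H A t (z : traj) m n : (forall k, 0 < (z k).2) ->
  at_jump H A t m z -> at_jump H A t n z -> m = n.
Proof.
move=> pos [_ _ /andP[m1 m2]] [_ _ /andP[n1 n2]].
have nd : {homo jt z : k l / (k <= l)%N >-> k <= l}.
  by apply/nondecreasing_seqP => k; rewrite /jt big_ord_recr/= lerDl ltW.
have mn : (m < n.+1)%N by rewrite ltnNge; apply/negP => /nd; lra.
have nm : (n < m.+1)%N by rewrite ltnNge; apply/negP => /nd; lra.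
by apply/eqP; rewrite eqn_leq -ltnS mn -ltnS nm.
Qed.

Lemma trivIset_at_jump (T : Type) (B : set T) (Z : T -> traj) H A t :
  (forall (w : T) k, B w -> 0 < (Z w k).2) ->
  trivIset setT (fun n => B `&` Z @^-1` at_jump H A t n).
Proof.
move=> pos; apply/trivIsetP => m n _ _ /eqP mn; apply/seteqP; split => // w [[Bw zm] [_ zn]].
by apply: mn; apply: (at_jump_uniq _ zm zn) => k; exact: pos.
Qed.

Lemma alive_sum H A t i : P i (run @^-1` alive H A t) =
  (\sum_(0 <= n <oo) P i (run @^-1` at_jump H A t n))%E.
Proof.
rewrite preimage_bigcup measure_bigcupT//; first by move=> n; exact: measurable_at_jump_run.
by have := @trivIset_at_jump _ setT run H A t (fun w k _ => hold_gt0 k w); under eq_fun do rewrite setTI.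
Qed.

Lemma measurable_J n : measurable_fun setT (J n).
Proof. exact: measurable_sum. Qed.

Lemma measurable_after n s N : measurable_fun setT (after n s : Omega -> horizon N).
Proof.
apply: measurable_traj => k _; first exact: mY.
rewrite /after /=; case: eqP => _; last exact: mhold.
by apply: measurable_funB => //; exact: measurable_J.
Qed.

Lemma jt_run n w : jt (run w) n = J n w. Proof. by []. Qed.

Lemma jtS (z : traj) n : jt z n.+1 = jt z n + (z n).2.
Proof. exact: big_ord_recr. Qed.

Lemma jt_after n s m w : jt (after n s w) m.+1 = J (n + m).+1 w - s.
Proof.
elim: m => [|m IH]; first by rewrite /jt big_ord1/= addn0.
by rewrite jtS IH [in RHS]addnS [in RHS]jump_timeS addrAC /= addnS.
Qed.

Lemma jt_shortened n u w : jt (shortened n u w) n.+1 = J n.+1 w - u.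
Proof.
rewrite /jt big_ord_recr/= eqxx jump_timeS addrA; congr (_ + _ - _).
by apply: eq_bigr => k _; rewrite /= ltn_eqF.
Qed.

Lemma jt_shortened_le n u w : jt (shortened n u w) n = J n w.
Proof. by apply: eq_bigr => k _; rewrite /= ltn_eqF. Qed.

Lemma after_gt0 H k s n w m :
  run w \in at_jump H [set k] s n -> 0 < (after n s w m).2.
Proof.
rewrite inE => -[_ _ /andP[_ sn]]; rewrite /after/=; case: eqP => // _.
by rewrite subr_gt0.
Qed.

(** The Markov property at the fixed time s, on the event of exactly n jumps by then. *)
Lemma restart H i k n s N (E : set (horizon N)) : measurable E ->
  P i (run @^-1` at_jump H [set k] s n `&` after n s @^-1` E) =
  (P i (run @^-1` at_jump H [set k] s n) * P k (run @^-1` E))%E.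
Proof.
move=> mE; have mC := measurable_at_jump_run H [set k] s n.
have cE : P i (run @^-1` at_jump H [set k] s n) =
    (fine (P i (run @^-1` at_jump H [set k] s n)))%:E.
  by rewrite fineK// fin_num_measure.
rewrite [X in (_ = X * _)%E]cE -[in RHS](setTI (run @^-1` E)).
apply: (@law_unique _ _ _ _ _ (P i) (P k) N) => //.
- exact: measurable_after.
- exact: measurable_run X_chain _.
- by rewrite fine_ge0// measure_ge0.
- by move=> w l Cw _; apply: (@after_gt0 H k); rewrite inE.
- by move=> w l _ _; exact: hold_gt0.
move=> y t t0; rewrite -cE setTI (law_cylinder X_chain)//.
have [yk|yk] := eqVneq (y 0%N) k; last first.
  rewrite /weight (negbTE yk) !mul0r mule0.
  rewrite [X in P i X](_ : _ = set0) ?measure0//.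
  apply/seteqP; split => // w [[_ /= Yn _] /(_ 0%N isT)[/= + _]].
  by rewrite addn0 Yn => /esym/eqP; rewrite (negbTE yk).
have := memoryless i N y t0 (@measurable_at_jump H [set k] s n).
rewrite yk => h; rewrite muleC.
(* The residual time [J n.+1 w - s] exceeds [t 0] exactly when s still lies in the n-th interval
   after that interval is shortened by [t 0]. *)
transitivity (P i (future n N y t `&` shortened n (t 0%N) @^-1` at_jump H [set k] s n)).
  congr (P i _); apply/seteqP; split => w.
    move=> [[Hw /= Yn /andP[ns sn]] cw].
    have [_] := cw 0%N isT; rewrite /= => t0w.
    split.
      move=> m mN; have [] := cw m mN; rewrite /=; case: eqP => [->|_ //] Yn' _; split => //.
      by rewrite addn0; move: t0w; rewrite jump_timeS; move: ns; rewrite jt_run; lra.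
    split => //=; rewrite jt_shortened_le ns jt_shortened; lra.
  move=> [fw [Hw /= Yn]]; rewrite jt_shortened_le jt_shortened => /andP[ns sn].
  have t00 := t0 0%N; split.
    by split => //=; rewrite !jt_run ns; lra.
  move=> m mN /=; have [] := fw m mN => -> th; split => //.
  by case: eqP => [->|//]; lra.
rewrite h; congr (_ * P i _)%E; apply/seteqP; split => w; first by case.
by move=> Cw; split => //; case: Cw.
Qed.

Lemma after_alive H A s t n k w : 0 <= s -> 0 <= t ->
  at_jump H [set k] s n (run w) ->
  (alive H A (s + t) (run w) <-> alive H A t (after n s w)).
Proof.
move=> s0 t0 [Hw _ /andP[]]; rewrite !jt_run => ns sn.
have nd := jump_time_nd X_chain w.
have jt0 : jt (after n s w) 0 = 0 by exact: big_ord0.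
split=> [[N _ [HN AN /andP[]]]|[m _ [Hm Am /andP[]]]].
  rewrite !jt_run => Nst stN.
  have nN : (n <= N)%N by rewrite -ltnS ltnNge; apply/negP => /nd; lra.
  exists (N - n)%N => //; split => /=.
  - by move=> l; rewrite leq_subRL// => lN; exact: HN.
  - by rewrite subnKC.
  rewrite jt_after subnKC//; apply/andP; split; last lra.
  have := subnKC nN; case: (N - n)%N => [|m] Nm; first by rewrite jt0.
  by rewrite jt_after -addnS Nm; lra.
rewrite jt_after => mt tm.
exists (n + m)%N => //; split => //=.
- move=> l ln; have [ln'|nl] := leqP l n; first exact: Hw.
  by have := Hm (l - n)%N; rewrite /= subnKC ?(ltnW nl)//; apply; rewrite leq_subLR.
- rewrite !jt_run; apply/andP; split; last lra.
  case: m mt {tm Hm Am} => [|m]; first by rewrite addn0; lra.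
  by rewrite jt_after addnS; lra.
Qed.

Lemma restart_alive H A i k n s t : 0 <= s -> 0 <= t ->
  P i (run @^-1` at_jump H [set k] s n `&` run @^-1` alive H A (s + t)) =
  (P i (run @^-1` at_jump H [set k] s n) * P k (run @^-1` alive H A t))%E.
Proof.
move=> s0 t0; rewrite alive_sum -nneseriesZl_fin; last 2 first.
- by rewrite fin_num_measure//; exact: measurable_at_jump_run.
- by move=> *; exact: measure_ge0.
under eq_eseriesr => m _ do rewrite -(restart H i k n s (@measurable_at_jump H A t m)).
rewrite -measure_bigcupT; first last.
- apply: trivIset_at_jump => w l Cw; apply: (@after_gt0 H k); by rewrite inE.
- move=> m; apply: measurableI; first exact: measurable_at_jump_run.
  rewrite -[X in measurable X]setTI; apply: (@measurable_after n s m measurableT).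
  exact: measurable_at_jump.
rewrite -setI_bigcupr; congr (P i _); apply/seteqP; split => w [Cw aw]; split => //.
  by have /(_ aw) := (@after_alive H A s t n k w s0 t0 Cw).1; rewrite /alive => -[m _ h]; exists m.
apply/(@after_alive H A s t n k w s0 t0 Cw); case: aw => m _ h; by exists m.
Qed.

(** A trajectory alive at s + t has not exploded by s, so it has a state k and a jump count n at
    time s; [restart_alive] applies to each pair. *)
Theorem chapman_kolmogorov H A i s t : 0 <= s -> 0 <= t ->
  P i (run @^-1` alive H A (s + t)) =
  (\sum_(0 <= k <oo) P i (run @^-1` alive H [set k] s) * P k (run @^-1` alive H A t))%E.
Proof.
move=> s0 t0; pose B k := run @^-1` alive H [set k] s `&` run @^-1` alive H A (s + t).
have mB k : measurable (B k) by apply: measurableI; exact: measurable_alive.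
have BE k : P i (B k) = (P i (run @^-1` alive H [set k] s) * P k (run @^-1` alive H A t))%E.
  rewrite muleC (alive_sum H [set k]) -nneseriesZl_fin; last 2 first.
  - by rewrite fin_num_measure//; exact: measurable_alive.
  - by move=> *; exact: measure_ge0.
  under eq_eseriesr do rewrite muleC -restart_alive//.
  rewrite -measure_bigcupT; first last.
  - apply/trivIsetP => m n _ _ /eqP mn; apply/seteqP; split => // w [[zm _] [zn _]].
    by apply: mn; apply: (at_jump_uniq _ zm zn) => l; exact: hold_gt0.
  - by move=> m; apply: measurableI; [exact: measurable_at_jump_run|exact: measurable_alive].
  by rewrite -setI_bigcupl /B preimage_bigcup.
under eq_eseriesr do rewrite -BE.
rewrite -measure_bigcupT//; last first.
  apply/trivIsetP => k l _ _ /eqP kl; apply/seteqP; split => // w [[[m _ zm] _] [[n _ zn] _]].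
  apply: kl; have [_ <- _] := zm; have [_ <- _] := zn.
  have mn : m = n.
    case: zm zn => _ _ m3 [_ _ n3]; exact: (jump_interval_uniq X_chain m3 n3).
  by rewrite mn.
congr (P i _); apply/seteqP; split => w; last by case=> k _ [].
move=> aw; have [N _ [HN AN /andP[+ +]]] := aw; rewrite !jt_run => JN JN1.
(* The least such n is the number of jumps made by time s. *)
have ex : exists n, s < J n.+1 w by exists N; lra.
case: (ex_minnP ex) => n sn min.
have ns : J n w <= s.
  case: n sn min => [|n] sn min; first by rewrite jump_time0.
  by rewrite leNgt; apply/negP => /min; rewrite ltnn.
have nN : (n <= N)%N by apply: min; lra.
exists (Y n w) => //; split => //; exists n => //; split => //=.
- by move=> l ln; apply: HN; exact: leq_trans nN.
- by rewrite !jt_run ns.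
Qed.

End MarkovProperty.

(** * Transition probabilities with taboo states *)

Section TransitionFunction.
Context {R : realType} {disp : measure_display} {Omega : measurableType disp}.
Variables (Q : nat -> nat -> R) (P : nat -> probability Omega R).
Variables (Y : nat -> Omega -> nat) (hold : nat -> Omega -> R).
Hypotheses (Q_sb : single_birth Q) (X_chain : markov_chain Q P Y hold).
Implicit Types (i j k l n m N : nat) (s t u : R) (w : Omega) (H A B : set nat).
Local Notation traj := (nat -> nat * R).
Local Notation q := (jump_rate Q).
Local Notation J := (jump_time hold).
Local Notation run := (run Y hold).

Let q_gt0 := jump_rate_gt0 Q_sb.
Let p_ge0 := jump_prob_ge0 Q_sb.

Definition occ H A i t : \bar R := P i (run @^-1` alive H A t).

Let malive H A t : measurable (run @^-1` alive H A t).
Proof. exact: (measurable_alive X_chain). Qed.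

Lemma occ_ge0 H A i t : (0 <= occ H A i t)%E. Proof. exact: measure_ge0. Qed.

Lemma occ_le1 H A i t : (occ H A i t <= 1)%E. Proof. exact: probability_le1. Qed.

Lemma occ_fin H A i t : occ H A i t \is a fin_num.
Proof. exact: fin_num_measure. Qed.

Lemma aliveP H A t w : alive H A t (run w) <->
  exists n, [/\ forall l, (l <= n)%N -> H (Y l w), A (Y n w) & J n w <= t < J n.+1 w].
Proof. by split=> [[n _ h]|[n h]]; exists n. Qed.

Lemma transE t i j : trans P Y hold t i j = fine (occ setT [set j] i t).
Proof.
congr (fine (P i _)); apply/seteqP; split => w /=.
  by move=> /(X_SomeP X_chain)[n [tn Yn]]; apply/aliveP; exists n.
by move=> /aliveP[n [_ Yn tn]]; apply/(X_SomeP X_chain); exists n.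
Qed.

Lemma alive_bigcup H t (F : nat -> set nat) :
  run @^-1` alive H (\bigcup_n F n) t = \bigcup_n (run @^-1` alive H (F n) t).
Proof.
apply/seteqP; split => w.
  by move=> /aliveP[n [Hn [m _ Fm] tn]]; exists m => //; apply/aliveP; exists n.
by move=> [m _ /aliveP[n [Hn Fm tn]]]; apply/aliveP; exists n; split => //; exists m.
Qed.

Lemma alive_setU H t A B : run @^-1` alive H (A `|` B) t =
  run @^-1` alive H A t `|` run @^-1` alive H B t.
Proof.
apply/seteqP; split => w.
  by move=> /aliveP[n [Hn [An|Bn] tn]]; [left|right]; apply/aliveP; exists n.
by move=> [] /aliveP[n [Hn An tn]]; apply/aliveP; exists n; split => //; [left|right].
Qed.

Lemma alive_disj H H' t A B : A `&` B = set0 ->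
  run @^-1` alive H A t `&` run @^-1` alive H' B t = set0.
Proof.
move=> AB; apply/seteqP; split => // w [/aliveP[n [_ An tn]] /aliveP[m [_ Bm tm]]].
have nm := jump_interval_uniq X_chain tn tm.
by move: Bm; rewrite -nm => Bn; have : (A `&` B) (Y n w) by []; rewrite AB.
Qed.

Lemma occ_setU H i t A B : A `&` B = set0 ->
  occ H (A `|` B) i t = (occ H A i t + occ H B i t)%E.
Proof. by move=> AB; rewrite /occ alive_setU measureU// alive_disj. Qed.

Lemma occ_bigcup H i t (F : nat -> set nat) : trivIset setT F ->
  occ H (\bigcup_n F n) i t = (\sum_(0 <= n <oo) occ H (F n) i t)%E.
Proof.
move=> tF; rewrite /occ alive_bigcup measure_bigcupT//.
by apply/trivIsetP => m n _ _ mn; rewrite alive_disj//; move/trivIsetP : tF; exact.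
Qed.

Lemma occ_states H i t : (\sum_(0 <= k <oo) occ H [set k] i t = occ H setT i t)%E.
Proof.
rewrite -occ_bigcup; last by apply/trivIsetP => m n _ _ /eqP mn; apply/seteqP; split => // k [-> ?]; exact: mn.
by congr (occ _ _ _ _); apply/seteqP; split => // k _; exists k.
Qed.

Lemma occ_CK H A i s t : 0 <= s -> 0 <= t ->
  occ H A i (s + t) = (\sum_(0 <= k <oo) occ H [set k] i s * occ H A k t)%E.
Proof. exact: (chapman_kolmogorov Q_sb X_chain). Qed.

Lemma diverging_alive t w : 0 <= t -> J n w @[n --> \oo] --> +oo ->
  exists n, J n w <= t < J n.+1 w.
Proof.
move=> t0 /cvgryPgt /(_ t)[N _ NJ].
have ex : exists n, t < J n.+1 w by exists N; apply: NJ => /=; exact: leqnSn.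
case: (ex_minnP ex) => n tn min; exists n; rewrite tn andbT.
case: n tn min => [|n] tn min; first by rewrite jump_time0.
by rewrite leNgt; apply/negP => /min; rewrite ltnn.
Qed.

Lemma occ_setT i t : non_explosive P hold -> 0 <= t -> occ setT setT i t = 1%E.
Proof.
move=> ne t0; apply/eqP; rewrite eq_le occ_le1/= -(ne i).
apply: le_measure; rewrite ?inE//; first exact: (measurable_diverging_jumps X_chain).
by move=> w /(diverging_alive t0)[n tn]; apply/aliveP; exists n.
Qed.

(** The case N = 0 of [memoryless], for an event that does not see the shortening of the n-th
    duration by u. *)
Lemma hold_indep i n k u (D : set (horizon n)) : 0 <= u -> measurable D ->
  (forall w, D (shortened Y hold n u w) <-> D (run w)) ->
  P i ([set w | Y n w = k /\ u < hold n w] `&` run @^-1` D) =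
  ((expR (- (q k * u)))%:E * P i ([set w | Y n w = k] `&` run @^-1` D))%E.
Proof.
move=> u0 mD DE.
have := @memoryless _ _ _ _ _ _ _ Q_sb X_chain i n 0 (fun=> k) (fun=> u) D (fun=> u0) mD.
rewrite /weight big_ord0 big_ord1 eqxx !mul1r => <-; congr (P i _).
apply/seteqP; split => w /=.
  by move=> [[Yn un] /DE Dw]; split => // m; rewrite leqn0 => /eqP ->; rewrite addn0.
by move=> [/(_ 0%N isT)]; rewrite addn0 => Yn /DE.
Qed.

End TransitionFunction.

(** * Doeblin's condition *)

Section DoeblinCondition.
Context {R : realType} (u : nat -> R -> set nat -> R).
Implicit Types (i j k n m N : nat) (s t : R) (A B : set nat).
Hypothesis u_ge0 : forall i t A, 0 <= u i t A.
Hypothesis u_setU : forall i t A B, A `&` B = set0 -> u i t (A `|` B) = u i t A + u i t B.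
Hypothesis u_setT : forall i t, 0 <= t -> u i t setT = 1.
Hypothesis u_sigma : forall i t (F : nat -> set nat), trivIset setT F ->
  \sum_(k < n) u i t (F k) @[n --> \oo] --> u i t (\bigcup_n F n).
Hypothesis u_CK : forall i s t A, 0 <= s -> 0 <= t ->
  (u i (s + t) A)%:E = (\sum_(0 <= k <oo) (u i s [set k] * u k t A)%:E)%E.
Hypothesis u_states : forall i t, 0 <= t -> (\sum_(0 <= k <oo) (u i t [set k])%:E = 1)%E.
Variables (T delta : R).
Hypotheses (T0 : 0 <= T) (delta0 : 0 < delta).
Hypothesis minor : forall i, delta <= u i T [set 0%N].

Lemma u_set0 i t : u i t set0 = 0.
Proof. by have := @u_setU i t set0 set0 (set0I _); rewrite set0U; lra. Qed.

Lemma u_setC i t A : 0 <= t -> u i t (~` A) = 1 - u i t A.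
Proof. by move=> t0; rewrite -(u_setT i t0) -(setUv A) u_setU ?setICr//; lra. Qed.

Lemma u_le1 i t A : 0 <= t -> u i t A <= 1.
Proof. by move=> t0; have := u_ge0 i t (~` A); rewrite u_setC//; lra. Qed.

Lemma delta_le1 : delta <= 1.
Proof. exact: le_trans (minor 0) (u_le1 _ _ T0). Qed.

(** In the Chapman-Kolmogorov sum the bound c is used at every intermediate state and the surplus e
    only at 0. Applied to the complement of A it gives upper bounds. *)
Lemma u_lower i s t A c e : 0 <= s -> 0 <= t -> 0 <= c -> 0 <= e ->
  c + e <= u 0 t A -> (forall k, c <= u k t A) -> c + u i s [set 0%N] * e <= u i (s + t) A.
Proof.
move=> s0 t0 c0 e0 ce cu; rewrite -lee_fin u_CK//.
have us0 k : (0 <= (u i s [set k])%:E)%E by rewrite lee_fin.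
rewrite nneseries_recl//; last by move=> k _; rewrite lee_fin mulr_ge0.
apply: (@le_trans _ _ ((u i s [set 0%N] * (c + e))%:E +
    \sum_(1 <= k <oo) (c%:E * (u i s [set k])%:E))%E); last first.
  apply: leeD; first by rewrite lee_fin ler_wpM2l.
  apply: lee_nneseries => k _; first by rewrite mule_ge0.
  by rewrite -EFinM lee_fin mulrC ler_wpM2l.
rewrite nneseriesZl//; have := u_states i s0; rewrite nneseries_recl// => h.
have : (\sum_(1 <= k <oo) (u i s [set k])%:E)%E = (1 - u i s [set 0%N])%:E.
  by rewrite EFinB -h [X in (X - _)%E]addeC addeK.
by move=> ->; rewrite -EFinM -EFinD lee_fin; lra.
Qed.

Let r : R := 1 - delta.
Let r_ge0 : 0 <= r. Proof. by rewrite subr_ge0 delta_le1. Qed.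

(* Each step of length T shrinks the oscillation of [u ^~ _ A] by the factor r. *)
Lemma u_contract n A : exists a, [/\ 0 <= a, a + r ^+ n <= 1 &
  forall i, a <= u i (n%:R * T) A <= a + r ^+ n].
Proof.
elim: n => [|n [a [a0 ar h]]].
  exists 0; rewrite add0r mul0r; split => // i.
  by rewrite u_ge0 u_le1.
have nT0 : 0 <= n%:R * T by rewrite mulr_ge0.
have /andP[ua ub] := h 0%N; set u0 := u 0 (n%:R * T) A in ua ub.
have rn0 : 0 <= r ^+ n by exact: exprn_ge0.
have d1 := delta_le1.
(* Mass at least delta sits at 0, where the value is u0: the lower bound rises by delta times the
   gap below u0, and the upper bound drops by delta times the gap above it. *)
exists (a + delta * (u0 - a)); rewrite exprS; split.
- by rewrite addr_ge0// mulr_ge0 ?subr_ge0// ltW.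
- have : 0 <= delta * (a + r ^+ n - u0) by rewrite mulr_ge0 ?subr_ge0// ltW.
  by rewrite /r; lra.
move=> i; rewrite mulrS mulrDl mul1r; apply/andP; split.
  apply: le_trans (@u_lower i T _ A a (u0 - a) T0 nT0 a0 _ _ _); last 3 first.
  - by rewrite subr_ge0.
  - by rewrite addrC subrK.
  - by move=> k; have /andP[] := h k.
  by rewrite lerD2l ler_wpM2r ?subr_ge0.
have TT : 0 <= T + n%:R * T by rewrite addr_ge0.
suff : 1 - a - r ^+ n + delta * (a + r ^+ n - u0) <= u i (T + n%:R * T) (~` A).
  by rewrite u_setC// /r; lra.
apply: le_trans (@u_lower i T _ (~` A) (1 - a - r ^+ n) (a + r ^+ n - u0) T0 nT0 _ _ _ _); last 4 first.
- by lra.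
- by rewrite subr_ge0.
- by rewrite u_setC// -/u0; lra.
- by move=> k; rewrite u_setC//; have /andP[] := h k; lra.
by rewrite lerD2l ler_wpM2r ?subr_ge0.
Qed.

(** Every later value averages values at time n T, so it stays in the same interval; this is
    [u_lower] with e = 0, for A and for its complement. *)
Lemma u_squeeze n A : exists a, forall t i, n%:R * T <= t -> a <= u i t A <= a + r ^+ n.
Proof.
have [a [a0 ar h]] := u_contract n A; exists a => t i nt.
have nT0 : 0 <= n%:R * T by rewrite mulr_ge0.
have s0 : 0 <= t - n%:R * T by rewrite subr_ge0.
rewrite -(subrK (n%:R * T) t); apply/andP; split.
  have := @u_lower i _ _ A a 0 s0 nT0 a0 (lexx _).
  rewrite addr0 mulr0 addr0; apply => [|k]; first by have /andP[] := h 0%N.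
  by have /andP[] := h k.
suff : 1 - a - r ^+ n <= u i (t - n%:R * T + n%:R * T) (~` A).
  have tt : 0 <= t - n%:R * T + n%:R * T by exact: addr_ge0.
  by rewrite u_setC//; lra.
have a1 : 0 <= 1 - a - r ^+ n by lra.
have := @u_lower i _ _ (~` A) (1 - a - r ^+ n) 0 s0 nT0 a1 (lexx _).
rewrite addr0 mulr0 addr0; apply => [|k]; rewrite u_setC//.
  by have /andP[] := h 0%N; lra.
by have /andP[] := h k; lra.
Qed.

(** An upper limit always exists, so no Cauchy argument is needed; [u_squeeze] turns it into a
    uniform limit. *)
Definition equilibrium A : R := fine (limn_esup (fun m => (u 0 (m%:R * T) A)%:E)).

Lemma equilibrium_dist n t i A : n%:R * T <= t -> `|u i t A - equilibrium A| <= r ^+ n.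
Proof.
move=> nt; have [a h] := u_squeeze n A.
have hm : \forall m \near \oo, a <= u 0 (m%:R * T) A <= a + r ^+ n.
  by exists n => // m /= nm; apply: h; rewrite ler_wpM2r ?ler_nat.
have lo : (a%:E <= limn_esup (fun m => (u 0 (m%:R * T) A)%:E))%E.
  by apply: limn_esup_ge; apply: filterS hm => m /andP[]; rewrite lee_fin.
have up : (limn_esup (fun m => (u 0 (m%:R * T) A)%:E) <= (a + r ^+ n)%:E)%E.
  by apply: limn_esup_le; apply: filterS hm => m /andP[]; rewrite lee_fin.
have /andP[ua ub] := h t i nt; rewrite /equilibrium.
case: (limn_esup _) lo up => [x| |] //=; rewrite !lee_fin => xa xb.
by rewrite ler_norml; lra.
Qed.

Lemma r_cvg : r ^+ n @[n --> \oo] --> 0.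
Proof. by apply: cvg_expr; rewrite ger0_norm// /r ltrBlDr ltrDl. Qed.

Lemma le0_of_le_r (c x : R) : (forall n, x <= c * r ^+ n) -> x <= 0.
Proof.
move=> h; apply: (@ler_cvg_to _ \oo _ _ (fun=> x) (fun n => c * r ^+ n)).
- exact: cvg_cst.
- by rewrite -(mulr0 c); apply: cvgMr; exact: r_cvg.
- exact: nearW.
Qed.

Let eq_dist n A := @equilibrium_dist n (n%:R * T) 0 A (lexx _).

Lemma equilibrium_ge0 A : 0 <= equilibrium A.
Proof.
rewrite -oppr_le0; apply: (@le0_of_le_r 1) => n.
by have := eq_dist n A; rewrite ler_norml mul1r; have := u_ge0 0 (n%:R * T) A; lra.
Qed.

Lemma equilibrium_setU A B : A `&` B = set0 ->
  equilibrium (A `|` B) = equilibrium A + equilibrium B.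
Proof.
move=> AB; apply/eqP; rewrite -subr_eq0 -normr_eq0 eq_le normr_ge0 andbT.
apply: (@le0_of_le_r 3) => n.
have := eq_dist n A; have := eq_dist n B; have := eq_dist n (A `|` B).
by rewrite u_setU// !ler_norml => /andP[? ?] /andP[? ?] /andP[? ?]; lra.
Qed.

Lemma equilibrium_setT : equilibrium setT = 1.
Proof.
apply/eqP; rewrite -subr_eq0 -normr_eq0 eq_le normr_ge0 andbT.
apply: (@le0_of_le_r 1) => n; have := eq_dist n setT.
by rewrite u_setT ?mulr_ge0// distrC mul1r.
Qed.

Lemma equilibrium_set0 : equilibrium set0 = 0.
Proof. by have := @equilibrium_setU set0 set0 (set0I _); rewrite set0U; lra. Qed.

(* Uniform convergence lets countable additivity pass to the limit. *)
Lemma equilibrium_sigma (F : nat -> set nat) : trivIset setT F ->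
  \sum_(k < n) equilibrium (F k) @[n --> \oo] --> equilibrium (\bigcup_n F n).
Proof.
move=> tF; apply/cvgrPdist_le => e e0.
have [m rm] : exists m, r ^+ m <= e / 3.
  have := r_cvg; move/cvgrPdist_le => /(_ (e / 3)) [|N _ /(_ N (leqnn N))] /=.
    by rewrite divr_gt0.
  by rewrite sub0r normrN => h; exists N; exact: le_trans (ler_norm _) h.
have part (mu : set nat -> R) : (forall A B, A `&` B = set0 -> mu (A `|` B) = mu A + mu B) ->
    mu set0 = 0 -> forall n, \sum_(k < n) mu (F k) = mu (\big[setU/set0]_(k < n) F k).
  move=> muU mu0; elim=> [|n IH]; first by rewrite !big_ord0.
  rewrite !big_ord_recr/= IH muU//.
  by move/trivIsetP : tF => tF; rewrite big_distrl/= big1// => k _; apply: tF => //; rewrite ltn_eqF.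
have e3 : 0 < e / 3 by rewrite divr_gt0.
have /cvgrPdist_le/(_ _ e3)[N _ NF] := @u_sigma 0%N (m%:R * T) F tF.
exists N => // n Nn; have := NF n Nn; rewrite /=.
rewrite (part (u 0%N (m%:R * T)) (@u_setU 0%N _) (u_set0 _ _)).
rewrite (part equilibrium equilibrium_setU equilibrium_set0).
have := eq_dist m (\big[setU/set0]_(k < n) F k); have := eq_dist m (\bigcup_n F n).
by rewrite !ler_norml => /andP[? ?] /andP[? ?] /andP[? ?]; apply/andP; split; lra.
Qed.

Definition equilibrium_measure (A : set nat) : \bar R := (equilibrium A)%:E.

Let em0 : equilibrium_measure set0 = 0%E.
Proof. by rewrite /equilibrium_measure equilibrium_set0. Qed.

Let em_ge0 A : (0 <= equilibrium_measure A)%E.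
Proof. by rewrite lee_fin equilibrium_ge0. Qed.

Let em_sigma : semi_sigma_additive equilibrium_measure.
Proof.
move=> F mF tF mUF; under eq_fun do rewrite big_mkord sumEFin.
by apply: cvg_EFin; [exact: nearW|exact: equilibrium_sigma].
Qed.

HB.instance Definition _ := isMeasure.Build _ _ _ equilibrium_measure em0 em_ge0 em_sigma.

Let em1 : equilibrium_measure setT = 1%E.
Proof. by rewrite /equilibrium_measure equilibrium_setT. Qed.

HB.instance Definition _ := Measure_isProbability.Build _ _ _ equilibrium_measure em1.

(** Splitting the states by the sign of D turns the sum into a difference of the values of D on two
    sets, each bounded by r^n; hence the factor 2. *)
Lemma sum_dist_equilibrium n t i N : n%:R * T <= t ->
  \sum_(j < N) `|u i t [set nat_of_ord j] - equilibrium [set nat_of_ord j]| <= 2 * r ^+ n.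
Proof.
move=> nt; pose D A := u i t A - equilibrium A.
have Dle A : `|D A| <= r ^+ n by exact: equilibrium_dist.
have DU A B : A `&` B = set0 -> D (A `|` B) = D A + D B.
  by move=> AB; rewrite /D u_setU// equilibrium_setU//; lra.
have D0 : D set0 = 0 by rewrite /D u_set0 equilibrium_set0 subr0.
have part (S : pred nat) m : \sum_(j < m | S j) D [set nat_of_ord j] = D [set j | (j < m)%N && S j].
  elim: m => [|m IH].
    by rewrite big_ord0 -D0; congr D; apply/seteqP; split.
  rewrite big_mkcond big_ord_recr/= -big_mkcond IH; case: ifP => Sm; last first.
    rewrite addr0; congr D; apply/seteqP; split => j /= /andP[jm Sj]; rewrite Sj andbT.
      exact: leqW.
    by move: jm; rewrite ltnS leq_eqVlt => /predU1P[jm|//]; rewrite jm Sm in Sj.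
  rewrite -DU; last by apply/seteqP; split => // j [/= /andP[jm _] jm']; rewrite jm' ltnn in jm.
  congr D; apply/seteqP; split => j /=.
    by move=> [/andP[jm ->]|->]; rewrite ?ltnSn ?Sm// ltnW.
  move=> /andP[+ Sj]; rewrite ltnS leq_eqVlt => /predU1P[->|jm]; first by right.
  by left; rewrite jm.
rewrite (bigID (fun j : 'I_N => 0 <= D [set nat_of_ord j]))/=.
rewrite (eq_bigr (fun j : 'I_N => D [set nat_of_ord j])); last by move=> j ?; rewrite ger0_norm.
rewrite [X in _ + X](eq_bigr (fun j : 'I_N => - D [set nat_of_ord j])); last first.
  by move=> j; rewrite -ltNge => ?; rewrite ltr0_norm.
rewrite sumrN (part (fun j => 0 <= D [set j])) (part (fun j => ~~ (0 <= D [set j]))).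
have := Dle [set j | (j < N)%N && (0 <= D [set j])].
have := Dle [set j | (j < N)%N && ~~ (0 <= D [set j])].
by rewrite !ler_norml => /andP[? ?] /andP[? ?]; lra.
Qed.

Lemma exists_equilibrium : exists pi : probability nat R, forall n t i N, n%:R * T <= t ->
  \sum_(j < N) `|u i t [set nat_of_ord j] - fine (pi [set nat_of_ord j])| <= 2 * (1 - delta) ^+ n.
Proof. by exists equilibrium_measure; exact: sum_dist_equilibrium. Qed.

End DoeblinCondition.

(** * Strong ergodicity *)

Section StrongErgodicity.
Context {R : realType} {disp : measure_display} {Omega : measurableType disp}.
Variables (Q : nat -> nat -> R) (P : nat -> probability Omega R).
Variables (Y : nat -> Omega -> nat) (hold : nat -> Omega -> R).
Hypotheses (Q_sb : single_birth Q) (X_chain : markov_chain Q P Y hold).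
Implicit Types (i j k l n m N : nat) (s t u : R) (w : Omega) (H A B : set nat).
Local Notation traj := (nat -> nat * R).
Local Notation q := (jump_rate Q).
Local Notation J := (jump_time hold).
Local Notation run := (run Y hold).
Local Notation occ := (occ P Y hold).
Local Notation return_time := (return_time Y hold).

Let q_gt0 := jump_rate_gt0 Q_sb.

Lemma l1_dist_ge0 (pi : probability nat R) t i : (0 <= l1_dist P Y hold pi t i)%E.
Proof. by apply: nneseries_ge0 => j *; rewrite lee_fin. Qed.

Lemma doeblin_strongly_ergodic (T delta : R) : non_explosive P hold -> 0 <= T -> 0 < delta ->
  (forall i, (delta%:E <= occ setT [set 0%N] i T)%E) -> strongly_ergodic P Y hold.
Proof.
move=> ne T0 d0 minor; pose u i t A : R := fine (occ setT A i t).
have uE i t A : (u i t A)%:E = occ setT A i t by rewrite /u fineK ?(occ_fin X_chain).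
have u0 i t A : 0 <= u i t A by rewrite fine_ge0// occ_ge0.
have uU i t A B : A `&` B = set0 -> u i t (A `|` B) = u i t A + u i t B.
  by move=> AB; apply: EFin_inj; rewrite EFinD !uE (occ_setU X_chain).
have uT i t : 0 <= t -> u i t setT = 1.
  by move=> t0; apply: EFin_inj; rewrite uE (occ_setT X_chain).
have us i t (F : nat -> set nat) : trivIset setT F ->
    \sum_(k < n) u i t (F k) @[n --> \oo] --> u i t (\bigcup_n F n).
  move=> tF; have : (fun n => (\sum_(k < n) u i t (F k))%:E) @ \oo --> (u i t (\bigcup_n F n))%:E.
    rewrite uE (occ_bigcup X_chain)//.
    rewrite (_ : (fun n => _) = (fun n => \sum_(0 <= k < n) occ setT (F k) i t)%E).
      by apply: is_cvg_nneseries => *; exact: occ_ge0.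
    by apply/funext => n; rewrite big_mkord -sumEFin; apply: eq_bigr => k _; rewrite uE.
  exact: fine_cvg.
have uCK i s t A : 0 <= s -> 0 <= t ->
    (u i (s + t) A)%:E = (\sum_(0 <= k <oo) (u i s [set k] * u k t A)%:E)%E.
  move=> s0 t0; rewrite uE (occ_CK Q_sb X_chain)//.
  by apply: eq_eseriesr => k _; rewrite EFinM !uE.
have u1 i t : 0 <= t -> (\sum_(0 <= k <oo) (u i t [set k])%:E = 1)%E.
  move=> t0; rewrite -(occ_setT X_chain i ne t0) -(occ_states X_chain).
  by apply: eq_eseriesr => k _; rewrite uE.
have um i : delta <= u i T [set 0%N] by rewrite -lee_fin uE.
have [pi h] := exists_equilibrium u0 uU uT us uCK u1 T0 d0 um.
have d1 : delta <= 1.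
  by rewrite -lee_fin; apply: le_trans (minor 0%N) (occ_le1 X_chain _ _ _ _).
exists pi; apply/fine_cvgP.
have bound e : 0 < e -> \forall t \near +oo, (ereal_sup (range (l1_dist P Y hold pi t)) <= e%:E)%E.
  move=> e0; have : (1 - delta) ^+ n @[n --> \oo] --> 0.
    by apply: cvg_expr; rewrite ger0_norm ?subr_ge0// ltrBlDr ltrDl.
  have e2 : 0 < e / 2 by rewrite divr_gt0.
  move=> /cvgrPdist_le/(_ _ e2)[N _ /(_ N (leqnn N))] /=.
  rewrite sub0r normrN => rN.
  have : \forall t \near +oo, N%:R * T <= t by apply: nbhs_pinfty_ge; exact: num_real.
  apply: filterS => t NT; apply: ge_ereal_sup => _ [i _ <-].
  apply: lime_le; first by apply: is_cvg_nneseries => *; rewrite lee_fin.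
  apply: nearW => m; rewrite big_mkord sumEFin lee_fin.
  under eq_bigr do rewrite (transE X_chain).
  by apply: le_trans (h N t i m NT) _; have := ler_norm ((1 - delta) ^+ N); lra.
have sup0 t : (0 <= ereal_sup (range (l1_dist P Y hold pi t)))%E.
  by apply: le_ereal_sup_tmp; exists (l1_dist P Y hold pi t 0%N); [exists 0%N|exact: l1_dist_ge0].
split.
  apply: filterS (bound 1 ltr01) => t h1.
  by rewrite ge0_fin_numE// (le_lt_trans h1)// ltry.
apply/cvgrPdist_le => e e0; apply: filterS (bound e e0) => t he /=.
rewrite sub0r normrN ger0_norm ?fine_ge0// -lee_fin fineK//.
by rewrite ge0_fin_numE// (le_lt_trans he)// ltry.
Qed.

(** Together with [Y n.+1 w = 0] it says that the first return to 0 is the jump n+1 and occurs by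
    time T. *)
Definition first_return_by T n : set traj :=
  avoid 0 n `&` [set z | \sum_(k < n.+1) (z k).2 <= T].

(* By Markov's inequality the chain returns to 0 within time T = 2M + 1 with
   probability at least 1/2; there it stays for a time T with probability c. *)
Lemma minorization (M : R) : (forall i, (0 < i)%N -> (mean_return P Y hold i 0 <= M%:E)%E) ->
  exists T delta : R, [/\ 0 <= T, 0 < delta & forall i, (delta%:E <= occ setT [set 0%N] i T)%E].
Proof.
move=> mM; have M0 : 0 <= M.
  rewrite -lee_fin; apply: le_trans (mM 1%N isT); apply: integral_ge0 => w _.
  exact: (return_time_ge0 X_chain).
(* Markov's inequality needs M / T <= 1/2; the summand 1 keeps T positive. *)
pose T := 2 * M + 1; have T0 : 0 < T by rewrite /T; lra.
pose c := expR (- (q 0 * T)).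
have c0 : 0 < c by exact: expR_gt0.
exists T, (c / 2); split; [exact: ltW|by rewrite divr_gt0|].
have c2 : c / 2 <= c by lra.
case=> [|i].
  apply: (@le_trans _ _ c%:E); first by rewrite lee_fin.
  have := avoid_tail Q_sb X_chain 0 0 0 (ltW T0); rewrite /= -/c => <-.
  have mE : measurable (run @^-1` (avoid 0 0 `&` [set z | T < (z 0%N).2])).
    apply: (measurable_event X_chain (n := 0)); apply: measurableI; first exact: measurable_avoid.
    exact: measurable_duration_gt.
  have mA := measurable_at X_chain 0 0.
  rewrite -(prob_inter1 mE mA (prob_start X_chain 0)).
  apply: le_measure; rewrite ?inE; [exact: measurableI|exact: measurable_alive X_chain _ _ _|].
  move=> w [[_ /= Tw] Y0]; exists 0%N => //; split => //=.
  by rewrite /jt big_ord0 big_ord1 /= ltW.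
pose D n := first_return_by T n : set (horizon n.+1).
have mD n : measurable (D n).
  apply: measurableI; first exact: measurable_avoid.
  exact: measurable_jump_time_le.
pose B n := [set w | Y n.+1 w = 0%N] `&` run @^-1` D n.
(* Here the chain also stays at 0 longer than T after its return by time T, hence is at 0 at time
   T. *)
pose Bh n := [set w | Y n.+1 w = 0%N /\ T < hold n.+1 w] `&` run @^-1` D n.
have mB n : measurable (B n).
  by apply: measurableI; [exact: (measurable_at X_chain)|exact: (measurable_event X_chain (mD n))].
have mBh n : measurable (Bh n).
  rewrite /Bh (_ : [set w | _ /\ _] = [set w | Y n.+1 w = 0%N] `&` [set w | T < hold n.+1 w])//.
  apply: measurableI; last exact: (measurable_event X_chain (mD n)).
  by apply: measurableI; [exact: (measurable_at X_chain)|exact: (measurable_hold_gt X_chain)].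
have BhE n : P i.+1 (Bh n) = (c%:E * P i.+1 (B n))%E.
  apply: (hold_indep Q_sb X_chain _ _ (ltW T0) (mD n)) => w.
  split=> -[av /= jn]; split => //=; move: jn; rewrite (eq_bigr (fun k : 'I_n.+1 => hold k w))//=.
    by move=> k _; rewrite ltn_eqF.
  by move=> jn; rewrite (eq_bigr (fun k : 'I_n.+1 => hold k w))// => k _; rewrite ltn_eqF.
have tB : trivIset setT B.
  apply/trivIsetP => m n _ _; wlog mn : m n / (m < n)%N.
    move=> wl; rewrite neq_ltn => /orP[|] lt; first by apply: wl => //; rewrite ltn_eqF.
    by rewrite setIC; apply: wl => //; rewrite ltn_eqF.
  move=> _; apply/seteqP; split => // w [[Ym _] [_ [av _]]].
  by have := av m.+1; rewrite /= mn Ym eqxx => /(_ isT).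
have tBh : trivIset setT Bh.
  move/trivIsetP : tB => tB; apply/trivIsetP => m n mT nT mn.
  by apply/seteqP; split => // w [[[Ym _] Dm] [[Yn _] Dn]]; rewrite -(tB m n mT nT mn).
have PB : (c%:E * P i.+1 (\bigcup_n B n) <= occ setT [set 0%N] i.+1 T)%E.
  rewrite measure_bigcupT// -nneseriesZl//.
  under eq_eseriesr do rewrite -BhE.
  rewrite -measure_bigcupT//; apply: le_measure; rewrite ?inE.
  - exact: bigcupT_measurable.
  - exact: measurable_alive X_chain _ _ _.
  move=> w [n _ [[Yn Tn] [_ /= JT]]]; exists n.+1 => //; split => //=.
  rewrite (jt_run Y) (jt_run Y); apply/andP; split; first exact: JT.
  by rewrite jump_timeS; have := jump_time_ge0 X_chain n.+1 w; lra.
apply: le_trans PB; rewrite EFinM; apply: lee_wpmul2l; first by rewrite lee_fin ltW.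
have mret := measurable_return_time X_chain 0.
pose S := [set w | (T%:E <= `|return_time 0 w|)%E].
have mS : measurable S.
  rewrite -[S]setTI; apply: measurable_lee => //.
  exact: measurableT_comp.
have PS : (P i.+1 S <= 2^-1%:E)%E.
  have : (T%:E * P i.+1 S <= mean_return P Y hold i.+1 0)%E.
    have := le_integral_abse (P i.+1) measurableT mret T0.
    rewrite setTI -/S (eq_integral (return_time 0))//.
    by move=> w _; rewrite gee0_abs// (return_time_ge0 X_chain).
  move=> /le_trans/(_ (mM i.+1 isT)).
  rewrite -[P i.+1 S]fineK ?fin_num_measure// -EFinM !lee_fin => h.
  rewrite -(ler_pM2l T0) (le_trans h)// /T; lra.
apply: (@le_trans _ _ (P i.+1 (~` S))).
  rewrite probability_setC//; move: PS; rewrite -[P i.+1 S]fineK ?fin_num_measure//.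
  by rewrite -EFinB !lee_fin; lra.
apply: le_measure; rewrite ?inE; [exact: measurableC|exact: bigcupT_measurable|].
move=> w /= /negP; rewrite -ltNge gee0_abs ?(return_time_ge0 X_chain)// => rT.
have nn : ~ never 0 (run w).
  by move=> /neverP nv; move: rT; rewrite (return_time_never X_chain).
have [N [+ YN first]] := first_return nn; case: N YN first => // N YN first _.
exists N => //; split => //; split => /=.
  by move=> k /andP[k0 kN]; apply: first; rewrite k0.
by move: rT; rewrite (return_time_first X_chain _ YN first)// lte_fin => /ltW.
Qed.

Lemma jump_prob_gt0 i j : 0 < Q i j -> 0 < jump_prob Q i j.
Proof.
move=> Qij; rewrite /jump_prob; case: eqP => [ij|_]; last by rewrite divr_gt0.
by have := q_gt0 i; rewrite /jump_rate {2}ij; lra.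
Qed.

Lemma reach_gt0 i k : exists n, (0 < P i [set w | Y n w = k])%E.
Proof.
have [s [/pathP path_s last_s]] := sb_irreducible Q_sb i k.
exists (size s); pose y l := nth 0%N (i :: s) l.
apply: (@lt_le_trans _ _ (P i (run @^-1` cylinder (size s) y (fun=> 0)))).
  rewrite (law_cylinder X_chain)// lte_fin /weight /y /= eqxx mul1r.
  apply: mulr_gt0; apply: prodr_gt0 => l _; last exact: expR_gt0.
  by apply: jump_prob_gt0; exact: path_s.
apply: le_measure; rewrite ?inE; [|exact: (measurable_at X_chain)|].
  exact: (measurable_event X_chain (@measurable_cylinder _ (size s) y _)).
move=> w /(_ (size s) (leqnn _))[/= -> _]; rewrite /y -last_s.
by rewrite -[LHS]/(nth 0%N (i :: s) (size (i :: s)).-1) nth_last.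
Qed.

(** Some integer c gives positive probability to reaching k at jump n by time c; holding k for
    longer than c then puts the chain at k at time c. *)
Lemma occ_gt0 i k : exists2 t : R, 0 <= t & (0 < occ setT [set k] i t)%E.
Proof.
have [n Pn] := reach_gt0 i k.
pose D c : set (horizon n) := [set z : traj | \sum_(l < n) (z l).2 <= c].
have mD c : measurable (D c) by exact: measurable_jump_time_le (leqnSn n).
have mA := measurable_at X_chain n k.
have mB c : measurable ([set w | Y n w = k] `&` run @^-1` D c).
  by apply: measurableI => //; exact: (measurable_event X_chain (mD c)).
have [c Pc] : exists c : nat, (0 < P i ([set w | Y n w = k] `&` run @^-1` D c%:R))%E.
  apply: contrapT => nc; suff : P i [set w | Y n w = k] = 0%E by move: Pn => /[swap] ->; rewrite ltxx.
  apply/eqP; rewrite eq_le measure_ge0 andbT.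
  rewrite (_ : [set w | Y n w = k] = \bigcup_(c : nat) ([set w | Y n w = k] `&` run @^-1` D c%:R)).
    apply: le_trans (le_mu_bigcup _ (fun c => mB c%:R) (bigcupT_measurable _ (fun c => mB c%:R))) _.
    rewrite eseries0// => c _ _; apply/eqP; rewrite eq_le measure_ge0 andbT.
    by rewrite leNgt; apply/negP => Pc; apply: nc; exists c.
  apply/seteqP; split => w; last by case=> c _ [].
  move=> Yn; exists (Num.bound (J n w)) => //; split => //=.
  by apply/ltW/archi_boundP; exact: (jump_time_ge0 X_chain).
exists c%:R => //; have c0 : 0 <= c%:R :> R by [].
have := @hold_indep _ _ _ _ _ _ _ Q_sb X_chain i n k c%:R (D c%:R) c0 (mD _).
move=> /(_ _) h.
apply: (@lt_le_trans _ _ ((expR (- (q k * c%:R)))%:E * P i ([set w | Y n w = k] `&` run @^-1` D c%:R))%E).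
  by rewrite mule_gt0// lte_fin expR_gt0.
rewrite -h; last first.
  move=> w; rewrite /D/= (eq_bigr (fun l : 'I_n => hold l w))// => l _.
  by rewrite ltn_eqF.
apply: le_measure; rewrite ?inE; [|exact: measurable_alive X_chain _ _ _|].
  rewrite (_ : [set w | _ /\ _] = [set w | Y n w = k] `&` [set w | c%:R < hold n w])//.
  rewrite -setIA setICA setIC; apply: measurableI; first exact: mB.
  exact: (measurable_hold_gt X_chain).
move=> w [[/= Yn ch] Jc]; exists n => //; split => //=.
rewrite !(jt_run Y); apply/andP; split; first exact: Jc.
by rewrite jump_timeS; have := jump_time_ge0 X_chain n w; lra.
Qed.

Lemma geometric_sum_le (r : R) n : 0 <= r -> r < 1 -> \sum_(k < n) r ^+ k <= (1 - r)^-1.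
Proof.
move=> r0 r1; rewrite -[leRHS]mul1r ler_pdivlMr ?subr_gt0//.
suff -> : (\sum_(k < n) r ^+ k) * (1 - r) = 1 - r ^+ n by rewrite gerBl exprn_ge0.
elim: n => [|n IH]; first by rewrite big_ord0 mul0r expr0 subrr.
by rewrite big_ord_recr/= mulrDl IH exprS; ring.
Qed.

(* x <= T * #{m : m T < x} *)
Lemma le_sum_tail (T : R) (x : \bar R) : 0 < T ->
  (x <= \sum_(0 <= m <oo) (T * ((m%:R * T)%:E < x)%E%:R)%:E)%E.
Proof.
move=> T0; have f0 m : (0 <= (T * ((m%:R * T)%:E < x)%E%:R)%:E)%E.
  by rewrite lee_fin mulr_ge0// ltW.
have part n : (forall m, (m < n)%N -> ((m%:R * T)%:E < x)%E) ->
    ((n%:R * T)%:E <= \sum_(0 <= m <oo) (T * ((m%:R * T)%:E < x)%E%:R)%:E)%E.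
  move=> h; apply: le_trans (nneseries_lim_ge n (fun k _ _ => f0 k)).
  rewrite big_mkord; under eq_bigr do rewrite h// mulr1.
  by rewrite sumEFin lee_fin sumr_const card_ord mulr_natl.
case: x f0 part => [x| |] f0 part; last exact: leNye.
- have ex : exists n : nat, x <= n%:R * T.
    exists (Num.bound `|x / T|); rewrite -ler_pdivrMr//.
    by rewrite (le_trans (ler_norm _))// ltW// archi_boundP.
  case: (ex_minnP ex) => n xn min.
  apply: le_trans (part n _); first by rewrite lee_fin.
  by move=> m mn; rewrite lte_fin ltNge; apply/negP => /min; rewrite leqNgt mn.
- rewrite leye_eq; apply/eqP/eqyP => A A0; pose n := Num.bound (A / T).
  apply: le_trans (part n _); last by move=> m _; exact: ltry.
  by rewrite lee_fin -ler_pdivrMr// ltW// archi_boundP// divr_ge0// ltW.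
Qed.

Lemma measurable_return_gt c : measurable [set w | (c%:E < return_time 0 w)%E].
Proof.
rewrite -[X in measurable X]setTI; apply: measurable_lte => //.
exact: (measurable_return_time X_chain).
Qed.

(* Before the return to 0 the chain started off 0 only visits positive states. *)
Lemma return_gt_occ i t : non_explosive P hold -> 0 <= t -> (0 < i)%N ->
  (P i [set w | (t%:E < return_time 0 w)%E] <= occ [set k | k != 0%N] setT i t)%E.
Proof.
move=> ne t0 i0; have mR := measurable_return_gt t.
have mA := measurable_at X_chain 0 i.
have mD := measurable_diverging_jumps X_chain.
rewrite -(prob_inter1 mR mA (prob_start X_chain i)).
rewrite -(prob_inter1 (measurableI _ _ mR mA) mD (ne i)).
apply: le_measure; rewrite ?inE.
- by apply: measurableI => //; exact: measurableI.
- exact: measurable_alive X_chain _ _ _.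
move=> w [[/= tR Y0] /(diverging_alive t0)[n tn]].
exists n => //; split => // l ln /=; apply/eqP => Yl.
have l0 : (0 < l)%N by rewrite lt0n; apply/eqP => l0; move: i0; rewrite -Y0 -l0 Yl.
have := return_time_le X_chain l0 Yl => /(lt_le_trans tR); rewrite lte_fin.
by have := jump_time_nd X_chain w ln; case/andP : tn; lra.
Qed.

(* The chain is at 0 at time T' with probability at least delta from every state,
   so the return time exceeds m T' with probability at most (1 - delta)^m. *)
Lemma strongly_ergodic_bound : non_explosive P hold -> strongly_ergodic P Y hold ->
  exists M : R, forall i, (0 < i)%N ->
    P i (run @^-1` never 0) = 0%E /\ (mean_return P Y hold i 0 <= M%:E)%E.
Proof.
move=> ne [pi cpi].
(* A probability on a countable set charges some state, which need not be 0. *)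
have [j pij] : exists j, 0 < fine (pi [set j]).
  apply: contrapT => nj; suff : pi setT = 0%E by rewrite probability_setT => /eqP; rewrite onee_eq0.
  rewrite (_ : setT = \bigcup_j [set j]); last by apply/seteqP; split => // k _; exists k.
  rewrite measure_bigcupT//; last first.
    by apply/trivIsetP => m n _ _ /eqP mn; apply/seteqP; split => // k [-> ?]; exact: mn.
  rewrite eseries0// => k _ _; apply/eqP; rewrite eq_le measure_ge0 andbT.
  rewrite -[leLHS]fineK ?fin_num_measure// lee_fin leNgt.
  by apply/negP => pk; apply: nj; exists k.
pose a := fine (pi [set j]) / 2; have a0 : 0 < a by rewrite divr_gt0.
have [T T1 Ta] : exists2 T, 1 <= T & forall i, (a%:E <= occ setT [set j] i T)%E.
  have /fine_cvgP[cfin cfine] := cpi.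
  have /cvgrPdist_lt/(_ _ a0) ca := cfine.
  (* T >= 1 makes the step [T'] below positive. *)
  have c1 : \forall t \near +oo, 1 <= t :> R by apply: nbhs_pinfty_ge; exact: num_real.
  have [T [[fT aT] T1]] : exists T, (ereal_sup (range (l1_dist P Y hold pi T)) \is a fin_num /\
      `|0 - fine (ereal_sup (range (l1_dist P Y hold pi T)))| < a) /\ 1 <= T.
    by apply: (@filter_ex _ (pinfty_nbhs R)); apply: filterI => //; exact: filterI.
  exists T => // i.
  have h : (`|fine (occ setT [set j] i T) - fine (pi [set j])|%:E <= l1_dist P Y hold pi T i)%E.
    rewrite -(transE X_chain); apply: le_trans (nneseries_lim_ge j.+1 _); last first.
      by move=> *; rewrite lee_fin.
    rewrite big_nat_recr//= leeDr// sume_ge0// => k _; by rewrite lee_fin.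
  have : (`|fine (occ setT [set j] i T) - fine (pi [set j])|%:E < a%:E)%E.
    apply: le_lt_trans h _; apply: (@le_lt_trans _ _ (ereal_sup (range (l1_dist P Y hold pi T)))).
      by apply: ereal_sup_ubound; exists i.
    rewrite -[ltLHS]fineK// lte_fin; move: aT; rewrite sub0r normrN.
    by apply: le_lt_trans; exact: ler_norm.
  rewrite lte_fin ltr_norml => /andP[ha _].
  by rewrite -[leRHS](fineK (occ_fin X_chain _ _ _ _)) lee_fin; move: ha; rewrite /a; lra.
(* A move from j to 0 within time s transfers the minorization at j to one at 0. *)
have [s s0 sj] := occ_gt0 j 0%N.
pose b := fine (occ setT [set 0%N] j s).
have b0 : 0 < b by apply: fine_gt0; rewrite sj (le_lt_trans (occ_le1 X_chain _ _ _ _))// ltry.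
pose T' := T + s; have T'0 : 0 < T' by rewrite /T'; lra.
have T0 : 0 <= T by lra.
pose delta := a * b; have d0 : 0 < delta by exact: mulr_gt0.
have minor i : (delta%:E <= occ setT [set 0%N] i T')%E.
  rewrite (occ_CK Q_sb X_chain)//.
  apply: le_trans (nneseries_lim_ge j.+1 _); last by move=> *; rewrite mule_ge0// occ_ge0.
  rewrite big_nat_recr//=; apply: (@le_trans _ _ (occ setT [set j] i T * occ setT [set 0%N] j s)%E).
    rewrite EFinM -[X in (_ <= _ * X)%E](fineK (occ_fin X_chain _ _ _ _)) -/b.
    by apply: lee_wpmul2r => //; rewrite lee_fin ltW.
  by rewrite leeDr// sume_ge0// => k _; rewrite mule_ge0// occ_ge0.
pose H : set nat := [set k | k != 0%N].
have d1 : delta <= 1 by rewrite -lee_fin; apply: le_trans (minor 0%N) (occ_le1 X_chain _ _ _ _).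
have one i : (occ H setT i T' <= (1 - delta)%:E)%E.
  have disj : run @^-1` alive H setT T' `&` run @^-1` alive setT [set 0%N] T' = set0.
    apply/seteqP; split => // w [/aliveP[n [Hn _ tn]] /aliveP[m [_ Ym tm]]].
    by have := Hn n (leqnn n); rewrite /H/= (jump_interval_uniq X_chain tn tm) Ym eqxx.
  have : (occ H setT i T' + occ setT [set 0%N] i T' <= 1)%E.
    rewrite -measureU//; [|exact: measurable_alive X_chain _ _ _|exact: measurable_alive X_chain _ _ _].
    apply: probability_le1; apply: measurableU; exact: measurable_alive X_chain _ _ _.
  have := minor i.
  rewrite -(fineK (occ_fin X_chain H setT i T')) -(fineK (occ_fin X_chain setT [set 0%N] i T')).
  by rewrite -EFinD !lee_fin; lra.
(* Chapman-Kolmogorov with 0 as taboo: each further stretch of length [T'] costs a factor 1 -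
   delta. *)
have iter m i : (occ H setT i (m%:R * T') <= ((1 - delta) ^+ m)%:E)%E.
  elim: m => [|m IH]; first by rewrite expr0 (occ_le1 X_chain).
  have mT0 : 0 <= m%:R * T' by rewrite mulr_ge0// ltW.
  rewrite mulrSr mulrDl mul1r (occ_CK Q_sb X_chain)//; last exact: ltW.
  apply: (@le_trans _ _ (\sum_(0 <= k <oo) (1 - delta)%:E * occ H [set k] i (m%:R * T'))%E).
    apply: lee_nneseries => k _; first by rewrite mule_ge0// occ_ge0.
    by rewrite muleC; apply: lee_wpmul2r => //; exact: occ_ge0.
  rewrite nneseriesZl; last by move=> *; exact: occ_ge0.
  rewrite (occ_states X_chain) exprS EFinM; apply: lee_wpmul2l => //.
  by rewrite lee_fin subr_ge0.
have tail m i : (0 < i)%N -> (P i [set w | ((m%:R * T')%:E < return_time 0 w)%E] <= ((1 - delta) ^+ m)%:E)%E.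
  move=> i0; apply: le_trans (iter m i); apply: return_gt_occ => //.
  by rewrite mulr_ge0// ltW.
have r0 : 0 <= 1 - delta by rewrite subr_ge0.
have r1 : 1 - delta < 1 by rewrite ltrBlDr ltrDl.
(* The sum of the series of terms [T' * (1 - delta) ^+ m]. *)
exists (T' * delta^-1) => i i0; split.
  have mnev := measurable_never X_chain 0.
  rewrite -[LHS]fineK ?fin_num_measure//; congr EFin.
  apply/eqP; rewrite eq_le fine_ge0 ?measure_ge0// andbT.
  apply: (@ler_cvg_to _ \oo _ _ (fun=> fine (P i (run @^-1` never 0))) (fun m => (1 - delta) ^+ m)).
  - exact: cvg_cst.
  - by apply: cvg_expr; rewrite ger0_norm.
  apply: nearW => m; rewrite -lee_fin fineK ?fin_num_measure//.
  apply: le_trans (tail m i i0); apply: le_measure; rewrite ?inE//.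
    exact: measurable_return_gt.
  by move=> w /neverP nv /=; rewrite (return_time_never X_chain)// ltry.
pose g m w : \bar R := (T' * (((m%:R * T')%:E < return_time 0 w)%E%:R))%:E.
have gE m w : g m w = (T'%:E * (\1_[set w | ((m%:R * T')%:E < return_time 0 w)%E] w)%:E)%E.
  rewrite /g EFinM indicE; congr (_ * (nat_of_bool _)%:R%:E)%E.
  by apply/idP/idP => [h|/set_mem //]; exact: mem_set.
have g0 m w : (0 <= g m w)%E by rewrite /g lee_fin mulr_ge0// ltW.
have mg m : measurable_fun setT (g m).
  rewrite (funext (gE m)); apply/measurable_EFinP; apply: measurable_funM => //.
  exact: measurable_indic (measurable_return_gt _).
apply: (@le_trans _ _ (\int[P i]_w (\sum_(0 <= m <oo) g m w))%E).
  apply: ge0_le_integral => //.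
  - by move=> w _; exact: (return_time_ge0 X_chain).
  - exact: (measurable_return_time X_chain).
  - by apply: ge0_emeasurable_sum.
  - by move=> w _; exact: le_sum_tail.
rewrite integral_nneseries//.
have gi m : (\int[P i]_w g m w = T'%:E * P i [set w | ((m%:R * T')%:E < return_time 0 w)%E])%E.
  have mr := measurable_return_gt (m%:R * T').
  under eq_integral do rewrite gE.
  rewrite ge0_integralZl//; last by rewrite lee_fin ltW.
    by rewrite integral_indic// setIT.
  by apply/measurable_EFinP; exact: measurable_indic.
apply: lime_le; first by apply: is_cvg_nneseries => m _ _; rewrite gi mule_ge0// lee_fin ltW.
apply: nearW => N; rewrite big_mkord.
apply: (@le_trans _ _ (\sum_(m < N) (T' * (1 - delta) ^+ m)%:E)%E).
  apply: lee_sum => m _; rewrite gi [leRHS]EFinM; apply: lee_wpmul2l; first by rewrite lee_fin ltW.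
  exact: tail.
rewrite sumEFin lee_fin -mulr_sumr ler_pM2l//.
by have := geometric_sum_le N r0 r1; rewrite (_ : 1 - (1 - delta) = delta) //; ring.
Qed.

End StrongErgodicity.

(** * The strong ergodicity criterion and the theorem *)

Section Criterion.
Context {R : realType} {disp : measure_display} {Omega : measurableType disp}.
Variables (Q : nat -> nat -> R) (P : nat -> probability Omega R).
Variables (Y : nat -> Omega -> nat) (hold : nat -> Omega -> R).
Hypotheses (Q_sb : single_birth Q) (X_chain : markov_chain Q P Y hold).

Definition excess (k : nat) : \bar R :=
  (\sum_(n < k.+1) ((Fseq Q 0 n)%:E * dlimsup Q - (dseq Q n)%:E))%E.

Lemma never_null i : certain_hit Q -> P i (run Y hold @^-1` never 0) = 0%E.
Proof. by move=> hit; apply/(never_null_iff Q_sb X_chain)/hit. Qed.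

(** State 0 can only jump to 1, so survival from 0 is controlled by survival from 1, and
    [certain_hit_from0] spreads it upwards. *)
Lemma certain_hit_of_never : P 1 (run Y hold @^-1` never 0) = 0%E -> certain_hit Q.
Proof.
move=> /(never_null_iff Q_sb X_chain) s1; apply: (certain_hit_from0 Q_sb).
have sE m : survival Q 0 m.+1 0%N = jump_prob Q 0 1 * survival Q 0 m 1%N.
  by rewrite /survival iterS /killed big_mkcond/= !big_ord_recr big_ord0/= !add0r.
have lim : (fun m => jump_prob Q 0 1 * survival Q 0 m 1%N) @ \oo --> (0 : R).
  by rewrite -(mulr0 (jump_prob Q 0 1)); apply: cvgMr.
rewrite -(cvg_shiftS (fun m => survival Q 0 m 0%N)).
under eq_fun do rewrite sE.
exact: lim.
Qed.

Lemma strong_ergodicity_criterion : non_explosive P hold ->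
  strongly_ergodic P Y hold <-> (ereal_sup (range excess) < +oo)%E.
Proof.
move=> ne; split=> [se|sup_fin].
  have [M hM] := strongly_ergodic_bound Q_sb X_chain ne se.
  have hit : certain_hit Q.
    by apply: certain_hit_of_never; exact: (hM 1%N isT).1.
  apply: (@le_lt_trans _ _ M%:E); last exact: ltry.
  apply: ge_ereal_sup => _ [k _ <-]; rewrite /excess -(mean_timeSE Q_sb)//.
  by rewrite -(mean_returnE Q_sb X_chain (hM k.+1 isT).1); exact: (hM k.+1 isT).2.
(* The term k = 0 of the supremum is d itself. *)
have dfin : (dlimsup Q < +oo)%E.
  rewrite ltey; apply/eqP => dy; move: sup_fin; rewrite ltNge leye_eq => /eqP; apply.
  apply/eqP; rewrite -leye_eq -{1}(sum_poisson_sol_pinfty Q_sb 0) -dy.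
  by apply: ereal_sup_ubound; exists 0%N.
have mt i : (0 < i)%N -> (mean_time Q 0 i < +oo)%E.
  have dE : dlimsup Q = (fine (dlimsup Q))%:E.
    by rewrite fineK// ge0_fin_numE// dlimsup_ge0.
  (* Any real c above d will do; d + 1 is chosen. *)
  apply: (@mean_time_dlimsup _ _ Q_sb (fine (dlimsup Q) + 1)).
  by rewrite dE lte_fin /= ltrDl.
have nev i : (0 < i)%N -> P i (run Y hold @^-1` never 0) = 0%E.
  by move=> i0; apply: (never_null_of_mean_time Q_sb X_chain ne); exact: mt.
have hit : certain_hit Q.
  by apply: certain_hit_of_never; exact: nev.
pose M := fine (ereal_sup (range excess)).
have supE : ereal_sup (range excess) = M%:E.
  rewrite fineK// fin_real// sup_fin andbT.
  apply: (@lt_le_trans _ _ (excess 0)); last by apply: ereal_sup_ubound; exists 0%N.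
  rewrite /excess big_ord1 Fseqii mul1e dseq0 sube0.
  exact: lt_le_trans ltNy0 (dlimsup_ge0 Q_sb).
have [T [delta [T0 d0 minor]]] : exists T delta : R,
    [/\ 0 <= T, 0 < delta & forall i, (delta%:E <= occ P Y hold setT [set 0%N] i T)%E].
  apply: (minorization Q_sb X_chain (M := M)) => -[//|i] _.
  rewrite (mean_returnE Q_sb X_chain) ?nev// (mean_timeSE Q_sb)// -supE.
  by apply: ereal_sup_ubound; exists i.
exact: (doeblin_strongly_ergodic Q_sb X_chain ne T0 d0 minor).
Qed.

End Criterion.

Theorem proposition5p2 (R : realType) (Q : nat -> nat -> R)
  (disp : measure_display) (Omega : measurableType disp)
  (P : nat -> probability Omega R)
  (Y : nat -> Omega -> nat) (hold : nat -> Omega -> R)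
  (Q_sb : single_birth Q) (X_chain : markov_chain Q P Y hold) :
  (recurrent P Y hold ->
     [/\ mean_return P Y hold 0 0 = (((Q 0%N 1%N)^-1)%:E + dlimsup Q)%E,
         forall n, (1 <= n)%N ->
           mean_return P Y hold n 0 =
             (\sum_(k < n)
                ((Fseq Q 0 k)%:E * dlimsup Q - (dseq Q k)%:E))%E,
         forall l : \bar R,
           dratio Q n @[n --> \oo] --> l -> dlimsup Q = l,
         positive_recurrent P Y hold <-> (dlimsup Q < +oo)%E
       & strongly_ergodic P Y hold <->
           (ereal_sup (range (fun k : nat =>
              \sum_(n < k.+1)
                ((Fseq Q 0 n)%:E * dlimsup Q - (dseq Q n)%:E))) < +oo)%E])
  /\
  (non_explosive P hold ->
     (strongly_ergodic P Y hold <->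
        (ereal_sup (range (fun k : nat =>
           \sum_(n < k.+1)
             ((Fseq Q 0 n)%:E * dlimsup Q - (dseq Q n)%:E))) < +oo)%E)).
Proof.
split; last exact: strong_ergodicity_criterion.
move=> rec; have [nev hit] := recurrent_certain_hit Q_sb X_chain rec.
have null0 i := never_null Q_sb X_chain i hit.
have mean00 : mean_return P Y hold 0 0 = ((Q 0%N 1%N)^-1%:E + dlimsup Q)%E.
  by rewrite (mean_returnE Q_sb X_chain)// (mean_time0E Q_sb) (mean_time1E Q_sb).
split => //.
- by case=> // n _; rewrite (mean_returnE Q_sb X_chain)// (mean_timeSE Q_sb).
- by move=> l; exact: dratio_limE.
- split=> [/(_ 0%N)|dfin b].
    by rewrite mean00; case: (dlimsup Q) => [x| |] //= _; rewrite ?ltry ?ltNyr.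
  by rewrite (mean_returnE Q_sb X_chain)//; exact: mean_return_time_fin.
- apply: strong_ergodicity_criterion => //.
  exact: (certain_hit_non_explosive Q_sb X_chain hit).
Qed.
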